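(* For all $p,k\in\mathbb{N}$, the class $\mathcal{G}_{p,k}$ of graphs having at most $p$ connected components and containing no bond of size more than $k$ is well-quasi-ordered by the contraction relation $\unlhd$.
   Context: Graphs are finite, may have parallel edges, but have no loops. An edge contraction identifies two adjacent vertices, deletes the loops thereby created, and keeps parallel edges. A graph $H$ is a contraction of $G$, written $H\unlhd G$, if $H$ can be obtained (up to isomorphism) from $G$ by a sequence of edge contractions. A bond is a minimal non-empty edge cut, i.e. a minimal set of edges whose removal increases the number of connected components; its size is its number of edges. A class $\mathcal{C}$ of graphs is well-quasi-ordered by $\unlhd$ if every infinite sequence $G_0,G_1,\dots$ of graphs of $\mathcal{C}$ contains indices $i<j$ with $G_i\unlhd G_j$ (equivalently, there is neither an infinite strictly decreasing sequence nor an infinite set of pairwise incomparable elements). *)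

(* Defs.v *)
From mathcomp Require Import all_boot.

Set Implicit Arguments.
Unset Strict Implicit.
Unset Printing Implicit Defensive.

(* Finite loopless multigraphs.  Edges are objects of their own, so that
   parallel edges are distinct edges with the same set of two ends; the graph
   without vertices is allowed. *)
Record mgraph := MGraph {
  vert : finType;
  edge : finType;
  ends : edge -> {set vert};
  ends_card2 : forall e, #|ends e| = 2
}.

Definition adjacent (G : mgraph) : rel (vert G) :=
  fun x y => [exists e : edge G, ends e == [set x; y]].

Definition n_components (G : mgraph) : nat := n_comp (@adjacent G) predT.

Definition isomorphic (G H : mgraph) : Prop :=
  exists (fV : vert G -> vert H) (fE : edge G -> edge H),
    [/\ bijective fV, bijective fE & forall e, ends (fE e) = fV @: ends e].

Section Contract.
Variables (G : mgraph) (x y : vert G) (neq_xy : x != y).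

(* The vertex obtained by identifying x and y is represented by x. *)
Definition contract_vert : finType := {v : vert G | v != y}.

Definition contract_proj (v : vert G) : contract_vert :=
  insubd (exist (fun v => v != y) x neq_xy) v.

(* The edges whose image under the projection is a singleton are the loops
   created by the identification; all other edges are kept. *)
Definition contract_edge : finType :=
  {e : edge G | #|contract_proj @: ends e| == 2}.

Definition contract_ends (e : contract_edge) : {set contract_vert} :=
  contract_proj @: ends (val e).

Lemma contract_ends_card2 e : #|contract_ends e| = 2.
Proof. exact: (eqP (valP e)). Qed.

Definition contract : mgraph := MGraph contract_ends_card2.
End Contract.

Inductive contraction (H : mgraph) : mgraph -> Prop :=
| contraction_iso G : isomorphic H G -> contraction H G
| contraction_step G (x y : vert G) (neq_xy : x != y) :
    adjacent x y -> contraction H (contract neq_xy) -> contraction H G.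

Section DeleteEdges.
Variables (G : mgraph) (F : {set edge G}).

Definition del_edge : finType := {e : edge G | e \notin F}.

Definition del_ends (e : del_edge) : {set vert G} := ends (val e).

Lemma del_ends_card2 e : #|del_ends e| = 2.
Proof. exact: ends_card2. Qed.

Definition del_edges : mgraph := MGraph del_ends_card2.
End DeleteEdges.

Definition separating (G : mgraph) : pred {set edge G} :=
  fun F => n_components G < n_components (del_edges F).

Definition bond (G : mgraph) (F : {set edge G}) : bool :=
  minset (@separating G) F.

Definition bounded_components_bonds (p k : nat) (G : mgraph) : Prop :=
  n_components G <= p /\ forall F : {set edge G}, bond F -> #|F| <= k.

Definition well_quasi_ordered (T : Type) (C : T -> Prop) (R : T -> T -> Prop)
    : Prop :=
  forall s : nat -> T, (forall i, C (s i)) ->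
    exists i j : nat, i < j /\ R (s i) (s j).

(* Main.v *)
(** Write P(k) for the assertion that connected rooted graphs without bonds of
    more than k edges, labelled over any well-quasi-order, are well-quasi-ordered
    by label- and root-respecting contraction; it is proved by induction on k.
    If G has no cut vertex and its largest bonds have k+1 edges, then two
    disjoint bonds of size k+1 would cut V into S, M, T, where by a Menger
    argument M splits into two connected halves both touching S and T; exchanging
    the halves gives two bonds of total size more than 2(k+1).  So both sides of a
    largest bond satisfy the bound k, and G is encoded by its two sides, each
    vertex being labelled with the bond edges it meets; P(k) applies to the sides.
    For graphs with cut vertices, G is a block B through the root with smaller
    rooted graphs attached at the vertices of B.  In a minimal bad sequence the
    attached graphs are well-quasi-ordered, hence so are the blocks labelled by
    them, which contradicts badness.  A graph with at most p components is handled
    by taking products. *)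

From Stdlib Require Import Classical ClassicalEpsilon.
Require Import Defs.
From mathcomp Require Import all_boot zify.

Set Implicit Arguments.
Unset Strict Implicit.
Unset Printing Implicit Defensive.

(** * Connected sets and edge counts *)

(** Contraction cannot delete edges, so multiplicities must match exactly when pieces are put
    together again. For the two sides of a bond this is forced by comparing the sets of bond edges
    in the labels for equality: the end of edge [i] then lies over the end of edge [i]. Equality of
    such sets is a well-quasi-order because the bond has a fixed size. For hanging parts it is
    forced by the root: every edge from a part to the rest of the graph leaves from the root of the
    part, so contractions between parts have to respect roots. Several vertices may lie over one
    block vertex, but only one of them has to carry a larger label; the parts at the others are
    contracted away. The Menger argument concerns only two disjoint connections; an extremal choice
    of a connected set does its work, so that no paths occur in it. *)

Definition fiber (V W : finType) (A : {set V}) (f : V -> W) (b : W) :=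
  [set x in A | f x == b].

Definition pullback (V W : finType) (A : {set V}) (f : V -> W) (X : {set W}) :=
  [set x in A | f x \in X].

Section Connectivity.
Variables (V : finType) (m : V -> V -> nat).
Hypothesis m_sym : forall x y, m x y = m y x.
Implicit Types (A B C D M U X Y Z S T : {set V}) (x y v w : V).

Definition ecount X Y := \sum_(x in X) \sum_(y in Y) m x y.

Definition touch X Y := [exists x in X, [exists y in Y, 0 < m x y]].

(* Connectedness through cuts: no notion of path is needed anywhere. *)
Definition conn A :=
  [forall U : {set V}, [|| A :&: U == set0, A :\: U == set0
                         | touch (A :&: U) (A :\: U)]].

Lemma touchP X Y :
  reflect (exists x y, [/\ x \in X, y \in Y & 0 < m x y]) (touch X Y).
Proof.
apply: (iffP exists_inP) => [[x xX /exists_inP[y yY xy]]|[x [y [xX yY xy]]]].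
  by exists x, y.
by exists x => //; apply/exists_inP; exists y.
Qed.

Lemma touch_sym X Y : touch X Y = touch Y X.
Proof.
by apply/touchP/touchP => -[x [y [xX yY xy]]]; exists y, x; rewrite m_sym.
Qed.

Lemma touchS X Y X' Y' :
  X \subset X' -> Y \subset Y' -> touch X Y -> touch X' Y'.
Proof.
move=> /subsetP XX' /subsetP YY' /touchP[x [y [/XX' xX /YY' yY xy]]].
by apply/touchP; exists x, y.
Qed.

Lemma ecount_sym X Y : ecount X Y = ecount Y X.
Proof.
rewrite /ecount exchange_big; apply: eq_bigr => y _.
by apply: eq_bigr => x _; rewrite m_sym.
Qed.

Lemma ecountUl X Y Z :
  [disjoint X & Y] -> ecount (X :|: Y) Z = ecount X Z + ecount Y Z.
Proof. move=> dXY; rewrite /ecount (eq_bigl [predU X & Y]) ?bigU // => x.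
by rewrite !inE. Qed.

Lemma ecountUr X Y Z :
  [disjoint X & Y] -> ecount Z (X :|: Y) = ecount Z X + ecount Z Y.
Proof. by move=> dXY; rewrite !(ecount_sym Z) ecountUl. Qed.

Lemma ecount_gt0 X Y : (0 < ecount X Y) = touch X Y.
Proof.
apply/idP/idP => [|/touchP[x [y [xX yY xy]]]].
  apply: contraTT => no; rewrite -leqNgt leqn0 /ecount big1 // => x xX.
  rewrite big1 // => y yY; apply/eqP; rewrite -leqn0 leqNgt.
  by apply: contra no => xy; apply/touchP; exists x, y.
rewrite /ecount (bigD1 x) //= (bigD1 y) //=.
by rewrite -addnA addn_gt0 xy.
Qed.

Lemma ecount_eq0 X Y : ~~ touch X Y -> ecount X Y = 0.
Proof. by rewrite -ecount_gt0 lt0n negbK => /eqP. Qed.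

Lemma ecountS X Y X1 Y1 : X1 \subset X -> Y1 \subset Y ->
  (forall x y, x \in X -> y \in Y -> 0 < m x y -> (x \in X1) && (y \in Y1)) ->
  ecount X Y = ecount X1 Y1.
Proof.
move=> X1X Y1Y H; rewrite /ecount (big_setID X1) /= (setIidPr X1X) [X in _ +
  X]big1.
  rewrite addn0; apply: eq_bigr => x xX1.
  rewrite (big_setID Y1) /= (setIidPr Y1Y) [X in _ + X]big1 ?addn0 // => y.
  rewrite inE => /andP[yY1 yY]; apply/eqP; rewrite -leqn0 leqNgt; apply/negP.
  by move=> /H; rewrite (subsetP X1X _ xX1) yY (negPf yY1) andbF => /(_ isT
    isT).
move=> x; rewrite inE => /andP[xX1 xX]; rewrite big1 // => y yY.
apply/eqP; rewrite -leqn0 leqNgt; apply/negP.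
by move=> /H; rewrite xX yY (negPf xX1) => /(_ isT isT).
Qed.

Lemma conn_cross A U x y : conn A ->
  x \in A -> x \in U -> y \in A -> y \notin U ->
  exists u v, [/\ u \in A, u \in U, v \in A, v \notin U & 0 < m u v].
Proof.
move=> /forallP/(_ U) cA xA xU yA yU; case/or3P: cA.
- by move=> /eqP/setP/(_ x); rewrite !inE xA xU.
- by move=> /eqP/setP/(_ y); rewrite !inE yA yU.
case/touchP=> u [v]; rewrite !inE => -[/andP[uA uU] /andP[vA vU] uv].
by exists u, v.
Qed.

Lemma connI A w : w \in A ->
  (forall U y, y \in A -> y \in U -> w \notin U ->
     exists u v, [/\ u \in A, u \in U, v \in A,
     v \notin U & 0 < m u v]) -> conn A.
Proof.
move=> wA H; apply/forallP => U; apply/or3P.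
have [|[x]] := set_0Vmem (A :&: U); first by move=> ->; constructor 1.
rewrite inE => /andP[xA xU].
have [|[y]] := set_0Vmem (A :\: U); first by move=> ->; constructor 2.
rewrite inE => /andP[yU yA]; constructor 3; apply/touchP.
have [wU|wU] := boolP (w \in U); last first.
  have [u [v [uA uU vA vU uv]]] := H U x xA xU wU.
  by exists u, v; rewrite !inE uA uU vA vU.
have [|||u [v]] := H (~: U) y; rewrite ?inE ?wU //.
move=> [uA uU vA /negPn vU uv]; exists v, u.
by rewrite !inE uA uU vA vU m_sym.
Qed.

Lemma conn0 : conn set0.
Proof. by apply/forallP => U; rewrite set0I eqxx. Qed.

Lemma conn1 x : conn [set x].
Proof. by apply: (@connI _ x) => [|U y]; rewrite inE // => /eqP-> ->. Qed.

(** The pieces [W b] hang on the points of a connected core [K]: a cut that separates two points of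
    [A] separates some piece from its core point, or else it cuts [K]. *)
Lemma conn_bigcup A K (W : V -> {set V}) : conn K -> K \subset A ->
  (forall b, b \in K -> [/\ conn (W b), b \in W b & W b \subset A]) ->
  (forall x, x \in A -> exists2 b, b \in K & x \in W b) -> conn A.
Proof.
move=> cK /subsetP KA HW HA; apply/forallP => U; apply/or3P.
have [|[x]] := set_0Vmem (A :&: U); first by move=> ->; constructor 1.
rewrite inE => /andP[xA xU].
have [|[y]] := set_0Vmem (A :\: U); first by move=> ->; constructor 2.
rewrite inE => /andP[yU yA]; constructor 3; apply/touchP.
suff [u [v [uA uU vA vU uv]]] :
  exists u v, [/\ u \in A, u \in U, v \in A, v \notin U & 0 < m u v].
  by exists u, v; rewrite !inE uA uU vA vU.
have [b bK xb] := HA x xA; have [c cK' yc] := HA y yA.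
have [cWb bb /subsetP WbA] := HW b bK; have [cWc cc /subsetP WcA] := HW c cK'.
have [bU|bU] := boolP (b \in U); last first.
  have [u [v [uA uU vA vU uv]]] := conn_cross cWb xb xU bb bU.
  by exists u, v; split=> //; apply: WbA.
have [cU|cU] := boolP (c \in U).
  have [u [v [uA uU vA vU uv]]] := conn_cross cWc cc cU yc yU.
  by exists u, v; split=> //; apply: WcA.
have [u [v [uA uU vA vU uv]]] := conn_cross cK bK bU cK' cU.
by exists u, v; split=> //; apply: KA.
Qed.

Lemma connU A B v : conn A -> conn B -> v \in A -> v \in B -> conn (A :|: B).
Proof.
move=> cA cB vA vB; apply: (@conn_bigcup _ A (fun b => if b == v then B :|:
  [set v] else [set b])) => //.
- exact: subsetUl.
- move=> b bA; case: eqVneq => [->|_].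
    have -> : B :|: [set v] = B by apply/setUidPl; rewrite sub1set.
    by split=> //; apply: subsetUr.
  by split; [exact: conn1|rewrite inE|rewrite sub1set inE bA].
move=> x; rewrite inE => /orP[xA|xB].
  by exists x => //; case: eqVneq => [->|_]; rewrite !inE ?eqxx ?orbT.
by exists v; rewrite ?eqxx // inE xB.
Qed.

Lemma conn2 x y : 0 < m x y -> conn [set x; y].
Proof.
move=> xy; apply: (@connI _ x) => [|U z]; rewrite !inE ?eqxx //.
move=> /orP[]/eqP-> ; first by move=> ->.
by move=> yU xU; exists y, x; rewrite !inE !eqxx orbT yU xU m_sym.
Qed.

Lemma connU_touch A B : conn A -> conn B -> touch A B -> conn (A :|: B).
Proof.
move=> cA cB /touchP[x [y [xA yB xy]]].
have -> : A :|: B = (A :|: [set x; y]) :|: B.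
  apply/setP=> z; rewrite !inE; case: (eqVneq z x) => [->|_];
    first by rewrite xA.
  by case: (eqVneq z y) => [->|_]; rewrite ?yB ?orbT ?orbF.
apply: (@connU _ _ y) => //; last by rewrite !inE eqxx !orbT.
by apply: (@connU _ _ x) => //; rewrite ?conn2 // !inE eqxx.
Qed.

Definition component C X := [&& conn C, C \subset X & ~~ touch C (X :\: C)].

Lemma component_ex X D x : D \subset X -> conn D -> x \in D ->
  exists2 C, component C X & D \subset C.
Proof.
move=> DX cD xD.
have [C /maxsetP[/andP[CX cC] Cmax] DC] :=
  @maxset_exists _ (fun C => (C \subset X) && conn C) D (introT andP (conj DX
    cD)).
exists C => //; rewrite /component CX cC; apply/touchP => -[u [v]].
rewrite inE => -[uC /andP[vC vX] uv].
have := Cmax (C :|: [set v]).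
rewrite subUset CX sub1set vX connU_touch ?conn1 //; last first.
  by apply/touchP; exists u, v; rewrite inE.
move=> /(_ isT (subsetUl _ _)) E; case/negP: vC.
by rewrite -E !inE eqxx orbT.
Qed.

(** All edges of [M] leaving [C] end at [v]. So for a cut of [M :\: C] with a side avoiding [v], the
    edge of [M] that leaves this side cannot run into [C]. *)
Lemma conn_compl_component M C v : conn M -> v \in M ->
  component C (M :\ v) -> conn (M :\: C).
Proof.
move=> cM vM /and3P[cC /subsetP CM noC].
have vC : v \notin C by apply/negP => /CM; rewrite !inE eqxx.
apply: (@connI _ v); first by rewrite inE vM vC.
move=> U y; rewrite inE => /andP[yC yM] yU vU.
have [||||u [w]] := @conn_cross M (U :\: C) y v cM;
  rewrite ?inE ?yU ?yC ?(negPf vU) ?andbF //.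
move=> [uM /andP[uC uU] wM wCU uw]; exists u, w; rewrite !inE uM uU uC wM.
have wC : w \notin C.
  apply/negP => wC; case/negP: noC; apply/touchP; exists w, u.
  rewrite !inE m_sym wC uC uM /= andbT; split=> //.
  by apply/eqP => E; rewrite E (negPf vU) in uU.
by move: wCU; rewrite wC.
Qed.

(** * Splitting a connected set into two linked halves *)

Section TwoLinked.
Variables S T : {set V}.

Definition linked C := [&& conn C, touch C S & touch C T].

(** Enlarging [D] to a component of [X - v] keeps its contacts with [S] and [T] and makes the
    complement connected. *)
Lemma linked_component X v D : conn X -> v \in X -> D \subset X :\ v ->
  linked D -> exists C, [/\ C \subset X :\ v, linked C & conn (X :\: C)].
Proof.
move=> cX vX DX /and3P[cD DS DT]; have [x [_ [xD _ _]]] := touchP _ _ DS.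
have [C compC DC] := component_ex DX cD xD; exists C.
have /and3P[cC CX _] := compC.
by rewrite /linked cC CX (conn_compl_component cX vX compC) !(touchS DC (subxx
  _)).
Qed.

(** The union of the components of [X - v] that touch [T]; its size is the quantity minimized in
    [two_linked]. *)
Definition far_side X v :=
  [set x in X :\ v | [exists D : {set V},
                       [&& D \subset X :\ v, conn D, x \in D & touch D T]]].

Lemma far_sideP X v x :
  reflect (exists D, [/\ D \subset X :\ v, conn D, x \in D & touch D T])
    (x \in far_side X v).
Proof.
rewrite inE; apply: (iffP andP) => [[_ /existsP[D /and4P[? ? ? ?]]]|[D [DX cD
  xD DT]]].
  by exists D.
split; first exact: (subsetP DX).
by apply/existsP; exists D; rewrite DX cD xD.
Qed.

(** Let [D] be the component of [X - v] around [w]. It touches [T], hence not [S], so [X :\: D]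
    touches [S]. A connected set avoiding [w] and touching [T] cannot contain [v]: its union with
    [X :\: D] would be linked and avoid [w]. The inclusion follows, and [w] itself is lost. *)
Lemma far_side_proper X v w : conn X -> v \in X -> touch X S ->
  (forall D, D \subset X :\ v -> ~~ linked D) ->
  (forall D, D \subset X :\ w -> ~~ linked D) ->
  w \in far_side X v -> far_side X w \proper far_side X v.
Proof.
move=> cX vX XS nov now wv; apply/properP; split; last first.
  by exists w => //; rewrite !inE eqxx.
have /far_sideP[D0 [D0X cD0 wD0 D0T]] := wv.
have [D compD D0D] := component_ex D0X cD0 wD0.
have cXD := conn_compl_component cX vX compD.
have /and3P[cD DX _] := compD; have wD := subsetP D0D _ wD0.
have vD : v \notin D by apply/negP => /(subsetP DX); rewrite !inE eqxx.
have DS : ~~ touch D S.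
  by have := nov D DX; rewrite /linked cD (touchS D0D (subxx _) D0T) andbT.
apply/subsetP => x /far_sideP[E [EX cE xE ET]]; apply/far_sideP.
have [vE|vE] := boolP (v \in E); last first.
  exists E; split=> //; apply/subsetP => y yE.
  rewrite !inE (contraNneq _ vE) => [|<-] //.
  by have := subsetP EX _ yE; rewrite !inE => /andP[].
have EXD : E :|: (X :\: D) \subset X :\ w.
  rewrite subUset EX; apply/subsetP=> y; rewrite !inE => /andP[yD ->].
  by rewrite andbT; apply: contraNneq yD => ->.
have /negP[] := now _ EXD.
apply/and3P; split; last by apply: touchS ET => //; apply: subsetUl.
  by apply: (@connU _ _ v) => //; rewrite inE vX vD.
have [s [t [sX tS st]]] := touchP _ _ XS; apply/touchP; exists s, t.
split=> //; rewrite !inE sX andbT; apply/orP; right.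
by apply: contra DS => sD; apply/touchP; exists s, t.
Qed.

Lemma two_linked M : conn M -> M != set0 ->
  (forall v, v \in M -> exists2 C : {set V}, C \subset M :\ v & linked C) ->
  exists P : {set V}, [/\ P \subset M, linked P & linked (M :\: P)].
Proof.
move=> cM /set0Pn[x0 x0M] HM.
pose good Y := [&& Y \subset M, conn Y, touch Y S & linked (M :\: Y)].
have [v0 v0M v0S] : exists2 v, v \in M & touch [set v] S.
  have [C CM /and3P[_ /touchP[v [s [vC sS vs]]] _]] := HM _ x0M.
  exists v; first by have := subsetP CM _ vC; rewrite !inE => /andP[].
  by apply/touchP; exists v, s; rewrite inE eqxx.
(* A linked component of [M - v0] has a connected complement, which contains [v0] and therefore
   touches [S]. *)
have [Y0 Y0good] : exists Y, good Y.
  have [C CM lC] := HM _ v0M.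
  have [D [DM lD cD]] := linked_component cM v0M CM lC.
  have DM' : D \subset M by apply: subset_trans DM (subsetDl _ _).
  have v0D : v0 \notin D by apply/negP => /(subsetP DM); rewrite !inE eqxx.
  exists (M :\: D); rewrite /good subsetDl cD setDDr setDv set0U (setIidPr DM')
    lD andbT /=.
  by apply: touchS v0S => //; rewrite sub1set inE v0M v0D.
(* Take Y maximal.  If Y misses T, every neighbour v of Y in X = M - Y separates
   S from T inside X; for v with minimal far side, hypothesis HM at v yields
   another such neighbour in that far side, hence with a smaller one. *)
have [Y /and4P[YM cY YS /and3P[cX XS XT]] Ymax] :=
  @arg_maxnP _ Y0 good (fun Y => #|Y|) Y0good.
set X := M :\: Y in cX XS XT.
have [YT|YT] := boolP (touch Y T).
  by exists Y; rewrite /linked -/X YM cY YS YT cX XS XT.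
have XM : X \subset M by apply: subsetDl.
pose N v := (v \in X) && touch [set v] Y.
(* By maximality of [Y]: for a linked component [C] of [X - v], the set [M :\: C] would be good too,
   being connected through the edge from [v] to [Y], and larger because it contains [v]. *)
have noN v : N v -> forall D, D \subset X :\ v -> ~~ linked D.
  move=> /andP[vX vY] D DX; apply/negP => lD.
  have [C [CX lC cXC]] := linked_component cX vX DX lD.
  have vC : v \notin C by apply/negP => /(subsetP CX); rewrite !inE eqxx.
  have CX' := subset_trans CX (subsetDl _ _).
  have CY y : y \in C -> y \notin Y.
    by move=> /(subsetP CX'); rewrite inE => /andP[].
  have /Ymax : good (M :\: C).
    have MMC : M :\: (M :\: C) = C.
      by rewrite setDDr setDv set0U (setIidPr (subset_trans CX' XM)).
    have YMC : Y \subset M :\: C.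
      by apply/subsetP=> y yY; rewrite inE (subsetP YM) // andbT;
        apply: contraL yY => /CY.
    rewrite /good subsetDl MMC lC andbT /= (touchS YMC (subxx _) YS) andbT.
    have -> : M :\: C = Y :|: (X :\: C).
      apply/setP=> y; rewrite !inE; have [yY|//] := boolP (y \in Y).
      by rewrite (subsetP YM) // andbT; apply: contraL yY => /CY.
    apply: connU_touch => //; rewrite touch_sym; apply: touchS vY => //.
    by rewrite sub1set in_setD vX vC.
  apply/negP; rewrite -ltnNge; apply: proper_card; apply/properP; split.
    by apply/subsetP=> y yY; rewrite inE (subsetP YM) // andbT;
      apply: contraL yY => /CY.
  move: vX; rewrite inE => /andP[vY' vM].
  by exists v => //; rewrite inE vC vM.
have [v1 Nv1] : exists v, N v.
  have [y [_ [yY _ _]]] := touchP _ _ YS; have [x [_ [xX _ _]]] := touchP _ _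
    XS.
  have [||||u [v [uM uY vM vY uv]]] := @conn_cross M Y y x cM => //.
  - exact: (subsetP YM).
  - exact: (subsetP XM).
  - by move: xX; rewrite inE => /andP[].
  exists v; rewrite /N inE vY vM; apply/touchP; exists v, u.
  by rewrite m_sym inE eqxx.
have [v Nv vmin] := @arg_minnP _ v1 N (fun v => #|far_side X v|) Nv1.
have /andP[vX vY] := Nv.
have [C CM /and3P[cC CS CT]] := HM v (subsetP XM _ vX).
have [t [z [tC zT tz]]] := touchP _ _ CT.
have tY : t \notin Y by apply: contra YT => tY; apply/touchP; exists t, z.
have tv : t \in X :\ v.
  by have := subsetP CM _ tC; rewrite !inE => /andP[-> ->]; rewrite tY.
have [y [yC yY]] : exists y, y \in C /\ y \in Y.
  apply: NNPP => no; have /negP[] : ~~ linked C;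
    last by rewrite /linked cC CS CT.
  apply: noN Nv _ _; apply/subsetP => y yC; have := subsetP CM _ yC;
    rewrite !inE => /andP[-> ->].
  by rewrite andbT; apply/negP => yY; apply: no; exists y.
have tF : t \in far_side X v.
  apply/far_sideP; exists [set t]; rewrite conn1 sub1set tv inE eqxx;
    split=> //.
  by apply/touchP; exists t, z; rewrite inE.
have yF : y \notin far_side X v.
  by apply/negP; rewrite inE => /andP[]; rewrite !inE yY andbF.
(* [C] runs from [t] in the far side of [v] to [y] in [Y] and avoids [v]. An edge of [C] leaving the
   far side can only enter [Y], since a vertex of [X - v] next to the far side belongs to it. So [u]
   is a neighbour of [Y] lying in the far side. *)
have [u [w [uC uF wC wF uw]]] := conn_cross cC tC tF yC yF.
have [D [DX cD uD DT]] := far_sideP _ _ _ uF.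
have wY : w \in Y.
  apply: contraR wF => wY; have wv : w \in X :\ v.
    by have := subsetP CM _ wC; rewrite !inE wY.
  apply/far_sideP; exists (D :|: [set w]); rewrite subUset DX sub1set wv !inE
    eqxx orbT.
  split=> //; last by apply: touchS DT => //; apply: subsetUl.
  apply: connU_touch => //; first exact: conn1.
  by apply/touchP; exists u, w; rewrite inE.
have Nu : N u.
  have := subsetP DX _ uD; rewrite !inE /N => /andP[_ /andP[uY uM]].
  by rewrite !inE uY uM; apply/touchP; exists u, w; rewrite inE eqxx.
have := vmin u Nu; rewrite leqNgt => /negP[]; apply: proper_card.
exact: far_side_proper cX vX XS (noN v Nv) (noN u Nu) uF.
Qed.

End TwoLinked.

(** * Bonds of maximum size *)

Definition nocut A := forall v, v \in A -> conn (A :\ v).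

Definition bonds_le k A := forall X, X \subset A -> X != set0 -> X != A ->
  conn X -> conn (A :\: X) -> ecount X (A :\: X) <= k.

(** Let [U] be [S] together with everything in [M - v] connected to [S] inside [M - v]. As [A - v]
    is connected, an edge leaves [U]; it cannot end in [M - v] by the choice of [U], so it ends in
    [T], and not coming from [S] it starts in a connected set touching both. *)
Lemma nocut_linked A S M T v : nocut A -> A = S :|: M :|: T ->
  [disjoint S & M] -> [disjoint T & M] -> [disjoint S & T] ->
  S != set0 -> T != set0 -> ~~ touch S T -> v \in M ->
  exists2 C : {set V}, C \subset M :\ v & linked S T C.
Proof.
move=> nA AE dSM dTM dST /set0Pn[s sS] /set0Pn[t tT] ST vM.
apply: NNPP => no.
have dis (B C : {set V}) : [disjoint B & C] -> forall x, x \in B -> x \notin C.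
  by move=> /disjointFr d x /d->.
pose U := S :|: [set x | [exists C : {set V},
  [&& C \subset M :\ v, conn C, x \in C & touch C S]]].
have cA : conn (A :\ v) by apply: nA; rewrite AE !inE vM orbT.
have svn x : x \in S -> x != v.
  by move=> xS; apply: contraTneq vM => <-; apply: dis xS.
have tvn x : x \in T -> x != v.
  by move=> xT; apply: contraTneq vM => <-; apply: dis xT.
have tU : t \notin U.
  rewrite !inE negb_or (contraL (dis _ _ dST t)) //=;
    apply/existsP => -[C /and4P[CM _ tC _]].
  by have := subsetP CM _ tC; rewrite !inE (negPf (dis _ _ dTM t tT)) andbF.
have [||||x [y [xA xU yA yU xy]]] := @conn_cross (A :\ v) U s t cA => //.
- by rewrite AE !inE sS svn.
- by rewrite !inE sS.
- by rewrite AE !inE tT orbT tvn.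
have yS : y \notin S by apply: contra yU; rewrite !inE => ->.
have [yT|yT] := boolP (y \in T).
  move: xU; rewrite !inE => /orP[xS|/existsP[C /and4P[CM cC xC CS]]].
    by case/negP: ST; apply/touchP; exists x, y.
  apply: no; exists C => //; rewrite /linked cC CS; apply/touchP.
  by exists x, y.
have yM : y \in M :\ v.
  by move: yA; rewrite AE !inE (negPf yS) (negPf yT) orbF.
case/negP: yU; rewrite inE; apply/orP; right; rewrite inE; apply/existsP.
move: xU; rewrite !inE => /orP[xS|/existsP[C /and4P[CM cC xC CS]]].
  exists [set y]; rewrite sub1set yM conn1 inE eqxx; apply/touchP.
  by exists y, x; rewrite inE m_sym.
exists (C :|: [set y]); rewrite subUset sub1set CM yM !inE eqxx orbT.
rewrite (touchS (subsetUl _ _) (subxx _) CS) andbT /=.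
rewrite andbT; apply: connU_touch => //; first exact: conn1.
by apply/touchP; exists x, y; rewrite inE.
Qed.

(* Generalizing and clearing first: lia's preprocessing would otherwise process
   all the boolean hypotheses on sets, and does not terminate in practice. *)
Ltac ecount_lia :=
  repeat match goal with
    |- context [ecount ?X ?Y] => generalize (ecount X Y)
  end; clear; intros; lia.

Lemma disjoint_setU X Y Z :
  [disjoint X :|: Y & Z] = [disjoint X & Z] && [disjoint Y & Z].
Proof. by rewrite -!setI_eq0 setIUl setU_eq0. Qed.

Lemma disjoint_setUr X Y Z :
  [disjoint Z & X :|: Y] = [disjoint Z & X] && [disjoint Z & Y].
Proof. by rewrite -!setI_eq0 setIUr setU_eq0. Qed.

Lemma bonds_leU k A X Y : bonds_le k A -> A = X :|: Y -> [disjoint X & Y] ->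
  X != set0 -> Y != set0 -> conn X -> conn Y -> ecount X Y <= k.
Proof.
move=> bA AE dXY X0 /set0Pn[y yY] cX cY.
have YE : A :\: X = Y.
  rewrite AE setDUl setDv set0U; apply/setDidPl.
  by rewrite disjoint_sym.
rewrite -YE; apply: bA => //; rewrite ?YE //; first by rewrite AE subsetUl.
apply: contraTneq yY => XA; have /setP/(_ y) := YE.
by rewrite XA setDv inE => <-.
Qed.

Lemma no_disjoint_max_bonds k A S M T :
  nocut A -> bonds_le k A -> A = S :|: M :|: T ->
  [disjoint S & M] -> [disjoint T & M] -> [disjoint S & T] ->
  conn S -> conn M -> conn T -> S != set0 -> M != set0 -> T != set0 ->
  ~~ touch S T ->
  k <= ecount S M -> ~~ (k <= ecount M T).
Proof.
move=> nA bA AE dSM dTM dST cS cM cT S0 M0 T0 ST kSM; apply/negP => kMT.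
have HM v : v \in M -> exists2 C : {set V}, C \subset M :\ v & linked S T C.
  by move=> vM; exact: nocut_linked nA AE dSM dTM dST S0 T0 ST vM.
have [P [PM /and3P[cP PS PT] /and3P[cQ QS QT]]] := two_linked cM M0 HM.
set Q := M :\: P in cQ QS QT.
have QM : Q \subset M by apply: subsetDl.
have PQ : [disjoint P & Q] by rewrite disjoint_sym disjoints_subset subsetDr.
have MPQ : M = P :|: Q by rewrite -[LHS](setID M P) (setIidPr PM).
(* The sum of this bound for (P, Q) and for (Q, P) exceeds 2k. *)
have bound P' Q' : M = P' :|: Q' -> [disjoint P' & Q'] -> linked S T P' ->
    linked S T Q' -> ecount S Q' + ecount P' T + ecount P' Q' <= k.
  move=> ME dPQ /and3P[cP' PS' _] /and3P[cQ' _ QT'].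
  have /andP[dPS dQS] : [disjoint P' & S] && [disjoint Q' & S].
    by rewrite -disjoint_setU -ME disjoint_sym.
  have /andP[dPT dQT] : [disjoint P' & T] && [disjoint Q' & T].
    by rewrite -disjoint_setU -ME disjoint_sym.
  have := @bonds_leU k A (S :|: P') (T :|: Q') bA.
  rewrite ecountUl 1?disjoint_sym // !ecountUr 1?disjoint_sym //.
  rewrite (ecount_eq0 ST) add0n addnA; apply.
  - by rewrite AE ME; apply/setP=> x; rewrite !inE; do 4 case: (x \in _).
  - rewrite disjoint_setU !disjoint_setUr dST dPT dPQ.
    by rewrite disjoint_sym dQS.
  - by apply: subset_neq0 S0; apply: subsetUl.
  - by apply: subset_neq0 T0; apply: subsetUl.
  - by apply: connU_touch => //; rewrite touch_sym.
  - by apply: connU_touch => //; rewrite touch_sym.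
have lP : linked S T P by apply/and3P.
have lQ : linked S T Q by apply/and3P.
have := bound P Q MPQ PQ lP lQ.
have := bound Q P; rewrite setUC disjoint_sym => /(_ MPQ PQ lQ lP).
move: kSM kMT; rewrite MPQ ecountUl // ecountUr //.
have : 0 < ecount P Q.
  rewrite ecount_gt0; have [p [_ [pP _ _]]] := touchP _ _ PS.
  have [q [_ [qQ _ _]]] := touchP _ _ QS.
  have qP : q \notin P by move: qQ; rewrite inE => /andP[].
  have [u [w [uM uP wM wP uw]]] := conn_cross cM (subsetP PM _ pP) pP (subsetP
    QM _ qQ) qP.
  by apply/touchP; exists u, w; rewrite inE wP.
rewrite (ecount_sym Q P); ecount_lia.
Qed.

(** Suppose that [X1] and [X2] form a bond of [X] with at least [k.+1] edges. If one of them misses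
    [Y], the other separates it from [Y] by two disjoint bonds of maximum size. If both touch [Y],
    then [X1] against [X2 :|: Y] is a bond of [A] with more than [k.+1] edges. *)
Lemma bonds_le_side k A X Y :
  nocut A -> bonds_le k.+1 A -> A = X :|: Y -> [disjoint X & Y] ->
  Y != set0 -> conn X -> conn Y -> ecount X Y = k.+1 -> bonds_le k X.
Proof.
move=> nA bA AE dXY Y0 cX cY kXY X1 X1X X10 X1neq cX1 cX2.
set X2 := X :\: X1 in cX2 *.
have XE : X = X1 :|: X2 by rewrite -[LHS](setID X X1) (setIidPr X1X).
have d12 : [disjoint X1 & X2] by rewrite disjoint_sym disjoints_subset subsetDr.
have X20 : X2 != set0.
  by apply: contraNneq X1neq => X20; rewrite eq_sym XE X20 setU0.
have [d1Y d2Y] : [disjoint X1 & Y] /\ [disjoint X2 & Y].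
  by move: dXY; rewrite XE disjoint_setU => /andP[].
rewrite leqNgt; apply/negP => k12.
have kY : ecount X1 Y + ecount X2 Y = k.+1 by rewrite -kXY XE ecountUl.
have [t1|t1] := boolP (touch X1 Y); last first.
  have := no_disjoint_max_bonds (k := k.+1) (A := A) (S := X1) (M := X2) (T :=
    Y) nA bA.
  rewrite k12 -XE => /(_ AE d12); rewrite disjoint_sym => /(_ d2Y d1Y cX1 cX2
    cY X10 X20 Y0 t1 isT).
  by rewrite -[X in X <= _]kY (ecount_eq0 t1) leqnn.
have [t2|t2] := boolP (touch X2 Y); last first.
  have := no_disjoint_max_bonds (k := k.+1) (A := A) (S := X2) (M := X1) (T :=
    Y) nA bA.
  rewrite (setUC X2) -XE (ecount_sym X2) k12 disjoint_sym => /(_ AE d12).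
  rewrite disjoint_sym => /(_ d1Y d2Y cX2 cX1 cY X20 X10 Y0 t2 isT).
  by rewrite -[X in X <= _]kY (ecount_eq0 t2) addn0 leqnn.
have := @bonds_leU k.+1 A X1 (X2 :|: Y) bA.
rewrite setUA -XE AE -setI_eq0 setIUr (disjoint_setI0 d12) (disjoint_setI0 d1Y)
  setU0 eqxx.
move=> /(_ erefl isT X10); rewrite (subset_neq0 (subsetUr _ _) Y0) (connU_touch
  cX2 cY t2).
move=> /(_ isT cX1 isT); rewrite ecountUr //.
have : 0 < ecount X1 Y by rewrite ecount_gt0.
move: k12 kY; ecount_lia.
Qed.

(** * Blocks as retracts *)

(* The part of the graph hanging off b in B is the fiber of pi over b.  A retract
   with at least two vertices that is minimal for its number of vertices has no
   cut vertex. *)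
Section Retraction.
Variables (A B : {set V}) (pi : V -> V).

Definition retraction :=
  [/\ B \subset A, forall x, x \in A -> pi x \in B,
      forall b, b \in B -> pi b = b
    & forall x y, x \in A -> y \in A -> 0 < m x y ->
        pi x = pi y \/ (x \in B /\ y \in B)].

Hypotheses (retr : retraction) (cA : conn A).

Lemma mem_fiber b : b \in B -> b \in fiber A pi b.
Proof. by case: retr => /subsetP BA _ piB _ bB;
  rewrite inE BA // piB ?eqxx. Qed.

Lemma fiber_exit b x y : x \in fiber A pi b -> y \in A ->
  y \notin fiber A pi b ->
  0 < m x y -> x = b /\ y \in B.
Proof.
case: retr => _ _ piB piE; rewrite inE => /andP[xA /eqP xb] yA;
  rewrite inE yA /= => yb xy.
case: (piE x y xA yA xy) => [xy'|[xB yB]]; first by rewrite -xy' xb eqxx in yb.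
by rewrite -xb piB.
Qed.

Lemma retraction_conn : conn B.
Proof.
have [/set0Pn[w wB]|/negPn/eqP->] := boolP (B != set0); last exact: conn0.
have [/subsetP BA piAB piB piE] := retr.
apply: (@connI _ w) => // U y yB yU wU.
have [||||u [v [uA uU vA vU uv]]] := @conn_cross A [set x | pi x \in U] y w cA;
  try by rewrite ?inE ?BA ?piB.
rewrite !inE in uU vU; case: (piE u v uA vA uv) => [E|[uB vB]].
  by rewrite -E uU in vU.
by exists u, v; rewrite piB // in uU; rewrite piB // in vU.
Qed.

Lemma fiber_conn b : b \in B -> conn (fiber A pi b).
Proof.
move=> bB; have [/subsetP BA piAB piB piE] := retr.
apply: (@connI _ b); first exact: mem_fiber.
move=> U y yF yU bU.
have yA : y \in A by move: yF; rewrite inE => /andP[].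
have [||||u [v [uA /setIP[uU uF] vA vU uv]]] := @conn_cross A (U :&: fiber A pi
  b) y b cA; try by rewrite ?in_setI ?yU ?yF ?(negPf bU) ?(BA b bB).
exists u, v.
have vF : v \in fiber A pi b.
  apply: contraR bU => vF; have [<- _] := fiber_exit uF vA vF uv.
  exact: uU.
by split=> //; move: vU; rewrite in_setI vF andbT.
Qed.

Lemma compl_fiber_conn b : b \in B -> conn (A :\: (fiber A pi b :\ b)).
Proof.
move=> bB; have [/subsetP BA piAB piB piE] := retr.
apply: (@connI _ b); first by rewrite !inE eqxx BA.
move=> U y; rewrite in_setD => /andP[yF yA] yU bU.
have yF' : y \notin fiber A pi b.
  by move: yF; rewrite in_setD1 negb_and negbK => /orP[/eqP E|//];
    rewrite -E yU in bU.
have [||||u [v [uA /setDP[uU uF] vA vU uv]]] := @conn_cross A (U :\: fiber A pi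
  b) y b cA; try by rewrite ?in_setD ?yU ?yF' ?(negPf bU) ?andbF ?(BA b bB).
have memR z : (z \in A :\: (fiber A pi b :\ b)) = (z \in A) && ((z == b) || (z
  \notin fiber A pi b)).
  by rewrite in_setD in_setD1 negb_and negbK andbC.
exists u, v; rewrite !memR uA uF uU vA uv orbT.
have [vF|vF] := boolP (v \in fiber A pi b); last first.
  by rewrite orbT; split=> //; apply: contra vU => vU; rewrite in_setD vF.
have [->] := fiber_exit vF uA uF (etrans (congr1 _ (m_sym _ _)) uv).
by rewrite eqxx.
Qed.

(** Exchanging the two sides, one may assume that [X] avoids [b]. Edges leave the fiber only from
    [b], so [X] has the same outgoing edges in [A] as in the fiber, and its complement in [A] is
    connected through [b]. *)
Lemma bonds_le_fiber k b : b \in B -> bonds_le k A -> bonds_le k (fiber A pi b).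
Proof.
move=> bB bA.
have main X : X \subset fiber A pi b -> X != set0 -> b \notin X -> conn X ->
    conn (fiber A pi b :\: X) -> ecount X (fiber A pi b :\: X) <= k.
  move=> XF X0 bX cX cFX.
  have FA : fiber A pi b \subset A by apply/subsetP => x;
    rewrite inE => /andP[].
  have bF := mem_fiber bB; have bA' := subsetP FA _ bF.
  have AX : A :\: X = (fiber A pi b :\: X) :|: (A :\: (fiber A pi b :\ b)).
    apply/setP => x; rewrite in_setU !in_setD in_set1.
    have [->|_] := eqVneq x b; first by rewrite bX bA' bF.
    have [xX|xX] := boolP (x \in X); first by rewrite (subsetP XF _ xX).
    have [xF|//] := boolP (x \in fiber A pi b);
      first by rewrite (subsetP FA _ xF).
  rewrite -(@ecountS X (A :\: X)) //.
  - apply: bA => //; first exact: subset_trans FA.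
      by apply: contraNneq bX => ->.
    rewrite AX; apply: (@connU _ _ b); rewrite ?compl_fiber_conn //.
      by rewrite inE bX.
    by rewrite !inE eqxx bA'.
  - by apply: setSD.
  - move=> x y xX; rewrite xX !in_setD => /andP[yX yA] xy; rewrite yX /=.
    apply: contraR bX => yF; have [<- //] := fiber_exit (subsetP XF _ xX) yA yF
      xy.
move=> X XF X0 XF' cX cFX; have [bX|bX] := boolP (b \in X); last exact: main.
have FFX : fiber A pi b :\: (fiber A pi b :\: X) = X by rewrite setDDr setDv
  set0U (setIidPr XF).
rewrite ecount_sym -{2}FFX; apply: main; rewrite ?FFX ?subsetDl //.
  by rewrite setD_eq0; apply: contra XF' => FX; rewrite eqEsubset XF.
by rewrite inE bX.
Qed.

Lemma pullback_conn X : X \subset B -> conn X -> conn (pullback A pi X).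
Proof.
move=> /subsetP XB cX; have [/subsetP BA piAB piB piE] := retr.
apply: (@conn_bigcup _ X (fiber A pi)) => //.
- by apply/subsetP => x xX; rewrite inE piB ?BA ?XB.
- move=> b bX; split; [exact/fiber_conn/XB|exact/mem_fiber/XB|].
  by apply/subsetP => x; rewrite !inE => /andP[-> /eqP->].
by move=> x; rewrite inE => /andP[xA xX]; exists (pi x) => //;
  rewrite inE xA eqxx.
Qed.

(** Pulling both sides back along [pi] yields a bond of [A] with the same edges, because an edge
    between different fibers lies inside [B]. *)
Lemma bonds_le_retraction k : bonds_le k A -> bonds_le k B.
Proof.
move=> bA X XB X0 XneqB cX cBX; have [/subsetP BA piAB piB piE] := retr.
have AX : A :\: pullback A pi X = pullback A pi (B :\: X).
  apply/setP=> x; rewrite !inE; have [xA|] := boolP (x \in A);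
    last by rewrite andbF.
  by rewrite piAB // !andbT.
have XA : X \subset pullback A pi X.
  by apply/subsetP => x xX; rewrite inE piB ?BA ?(subsetP XB).
rewrite -(@ecountS (pullback A pi X) (A :\: pullback A pi X)) //; last first.
- move=> x y; rewrite AX !inE => /andP[xA xX] /and3P[yA yX yB] xy.
  case: (piE x y xA yA xy) => [E|[xB yB']]; first by rewrite -E xX in yX.
  by rewrite -(piB x) // xX yB' -(piB y) // yX.
- by rewrite AX; apply/subsetP => y; rewrite !inE => /andP[yX yB];
    rewrite BA ?piB ?yX.
apply: bA; rewrite ?AX; try by apply: pullback_conn; rewrite ?subsetDl.
- by apply/subsetP=> x; rewrite inE => /andP[].
- exact: subset_neq0 XA X0.
apply: contraNneq XneqB => LA; rewrite eqEsubset XB; apply/subsetP=> x xB.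
by have := BA x xB; rewrite -LA inE piB // => /andP[].
Qed.

Lemma card_fiber b : 1 < #|B| -> b \in B -> #|fiber A pi b| < #|A|.
Proof.
move=> B1 bB; have [/subsetP BA piAB piB piE] := retr.
have [c cB cb] : exists2 c, c \in B & c != b.
  have : 0 < #|B :\ b| by move: B1; rewrite (cardsD1 b B) bB.
  by rewrite card_gt0 => /set0Pn[c]; rewrite !inE => /andP[]; exists c.
apply: proper_card; apply/properP; split.
  by apply/subsetP=> x; rewrite inE => /andP[].
by exists c; rewrite ?BA // inE piB // (negPf cb) andbF.
Qed.

End Retraction.

(** Splitting at a cut vertex [v]: [Z] is a union of components of [B - v], and whatever retracted
    to the other components now hangs at [v]. *)
Lemma retraction_shrink A B pi v Z : conn A -> retraction A B pi -> v \in B ->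
  Z \subset B :\ v -> ~~ touch Z ((B :\ v) :\: Z) ->
  retraction A (v |: Z) (fun x => if pi x \in v |: Z then pi x else v).
Proof.
move=> cA [/subsetP BA piAB piB piE] vB ZB noZ; split.
- apply/subsetP=> x; rewrite !inE => /orP[/eqP->|/(subsetP ZB)];
    first exact: BA.
  by rewrite !inE => /andP[_ /BA].
- by move=> x xA; case: ifP => // _; rewrite !inE eqxx.
- move=> b bZ; rewrite piB ?bZ //; move: bZ; rewrite !inE =>
    /orP[/eqP->//|/(subsetP ZB)].
  by rewrite !inE => /andP[].
move=> x y xA yA xy; case: (piE x y xA yA xy) => [->|[xB yB]]; first by left.
rewrite (piB x xB) (piB y yB).
have noE x' y' : x' \in B -> y' \in B -> 0 < m x' y' -> x' \in v |: Z -> y'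
  \notin v |: Z -> x' = v.
  move=> x'B y'B xy' ; rewrite !inE negb_or => /orP[/eqP//|x'Z] /andP[y'v y'Z].
  by case/negP: noZ; apply/touchP; exists x', y'; rewrite !inE y'v y'Z.
have [xZ|xZ] := boolP (x \in v |: Z); have [yZ|yZ] := boolP (y \in v |: Z).
- by right.
- by left; apply: noE xZ yZ.
- by left; symmetry; apply: noE yZ xZ; rewrite // m_sym.
- by left.
Qed.

(** Descent on the size of [B], from the identity retraction: at a cut vertex [v], keep [v] with a
    side such that [r] is kept. *)
Lemma block_ex A r : conn A -> r \in A -> 1 < #|A| ->
  exists B pi, [/\ retraction A B pi, r \in B, 1 < #|B| & nocut B].
Proof.
move=> cA rA A1.
have : exists B pi, [/\ retraction A B pi, r \in B & 1 < #|B|].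
  by exists A, id; split=> //; split=> // x y xA yA _; right.
move=> [B0 [pi0 [retr0 rB0 B01]]]; have [n leBn] := ubnP #|B0|.
elim: n => // n IH in B0 pi0 retr0 rB0 B01 leBn *.
have [nB|nB] := classic (nocut B0); first by exists B0, pi0.
have [v nBv] := not_all_ex_not _ _ nB.
have [vB /negP] := imply_to_and _ _ nBv.
rewrite /conn negb_forall => /existsP[U]; rewrite !negb_or.
set C := B0 :\ v => /and3P[/set0Pn[x xCU] /set0Pn[y yCU] noU].
have red Z y' : Z \subset C -> Z != set0 -> y' \in C :\: Z -> ~~ touch Z (C :\:
  Z) -> r \in v |: Z ->
    exists B pi, [/\ retraction A B pi, r \in B, 1 < #|B| & nocut B].
  move=> ZC Z0; rewrite inE => /andP[y'Z y'C] noZ rZ.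
  have vZ : v \notin Z by apply/negP => /(subsetP ZC); rewrite !inE eqxx.
  apply: IH (retraction_shrink cA retr0 vB ZC noZ) rZ _ _.
    by rewrite cardsU1 vZ ltnS card_gt0.
  apply: leq_ltn_trans (_ : #|B0 :\ y'| < n).
    apply/subset_leq_card/subsetP => z; rewrite !inE => /orP[/eqP->|zZ].
      by rewrite vB eq_sym andbT; move: y'C; rewrite !inE => /andP[].
    have := subsetP ZC _ zZ; rewrite !inE => /andP[_ ->].
    by rewrite andbT; apply: contraTneq zZ => ->.
  move: leBn; rewrite (cardsD1 y' B0); move: y'C; rewrite !inE => /andP[_ ->].
  by rewrite add1n.
have CI : C :\: (C :&: U) = C :\: U by rewrite setDIr setDv set0U.
have CD : C :\: (C :\: U) = C :&: U by rewrite setDDr setDv set0U.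
have [rU|rU] := boolP (r \in v |: (C :&: U)).
  apply: (red (C :&: U) y); rewrite ?CI //; first exact: subsetIl.
  by apply/set0Pn; exists x.
apply: (red (C :\: U) x); rewrite ?CD //; first exact: subsetDl.
- by apply/set0Pn; exists y.
- by rewrite touch_sym.
move: rU; rewrite !inE rB0 /=.
by case: eqP => //= _; rewrite !andbT.
Qed.

End Connectivity.

(** * Well-quasi-orders *)

Lemma subsequence (P : nat -> Prop) : (forall n, exists2 m, n <= m & P m) ->
  exists phi : nat -> nat,
    (forall i, P (phi i)) /\ (forall i j, i < j -> phi i < phi j).
Proof.
move=> HP; have /choice[g Hg] : forall n, exists m, n <= m /\ P m.
  by move=> n; have [m nm Pm] := HP n; exists m.
exists (fun i => iter i (fun x => g x.+1) (g 0)); split.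
  by move=> [|i] /=; [case: (Hg 0)|case: (Hg (iter i (fun x => g x.+1) (g
    0)).+1)].
apply: (homo_ltn (r := fun a b : nat => a < b)) => [y x z|i /=];
  first exact: ltn_trans.
by case: (Hg (iter i (fun x => g x.+1) (g 0)).+1).
Qed.

Section WellQuasiOrder.
Variables (T : Type) (R : T -> T -> Prop).
Implicit Types (C D : T -> Prop) (s : nat -> T).

Lemma wqoS C D : (forall x, D x -> C x) ->
  well_quasi_ordered C R -> well_quasi_ordered D R.
Proof. by move=> DC wC s Ds; apply: wC => i; apply: DC. Qed.

Lemma wqoU C D : well_quasi_ordered C R -> well_quasi_ordered D R ->
  well_quasi_ordered (fun x => C x \/ D x) R.
Proof.
move=> wC wD s Hs.
have sub E : well_quasi_ordered E R -> (forall n, exists2 m, n <= m & E (s m))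
  ->
    exists i j, i < j /\ R (s i) (s j).
  move=> wE /subsequence[phi [HE mono]].
  by have [i [j [ij Rij]]] := wE _ HE; exists (phi i), (phi j); split;
    first exact: mono.
have [HC|/not_all_ex_not[n0 Hn0]] := classic (forall n, exists2 m, n <= m & C
  (s m)).
  exact: (sub C).
apply: (sub D) => // n; exists (maxn n n0); first exact: leq_maxl.
by case: (Hs (maxn n n0)) => // Cs; case: Hn0; exists (maxn n n0);
  rewrite ?leq_maxr.
Qed.

(** Encodings are given by a relation [D], since they depend on choices: of a bond and the numbering
    of its edges, or of a block. *)
Lemma wqo_reflect (T' : Type) (R' : T' -> T' -> Prop) (C' : T' -> Prop) C
    (D : T -> T' -> Prop) :
  well_quasi_ordered C' R' -> (forall x, C x -> exists2 y, C' y & D x y) ->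
  (forall x y x' y', C x -> C x' -> D x y -> D x' y' -> R' y y' -> R x x') ->
  well_quasi_ordered C R.
Proof.
move=> wC' HD HR s Cs.
have /choice[t Ht] : forall i, exists y, C' y /\ D (s i) y.
  by move=> i; have [y Cy Dy] := HD _ (Cs i); exists y.
have [i [j [ij Rij]]] := wC' t (fun i => proj1 (Ht i)); exists i, j; split=> //.
exact: HR (Cs i) (Cs j) (proj2 (Ht i)) (proj2 (Ht j)) Rij.
Qed.

Hypothesis R_trans : forall y x z, R x y -> R y z -> R x z.

(** Infinitely many indices without a later larger entry would form a bad subsequence. Beyond the
    last such index one can jump forever from an entry to a larger one. *)
Lemma wqo_chain C s : well_quasi_ordered C R -> (forall i, C (s i)) ->
  exists phi : nat -> nat, forall i j, i < j ->
    phi i < phi j /\ R (s (phi i)) (s (phi j)).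
Proof.
move=> wC Cs; pose terminal i := forall j, i < j -> ~ R (s i) (s j).
have [H|/not_all_ex_not[N HN]] := classic (forall n, exists2 m, n <= m &
  terminal m).
  have [phi [Ht mono]] := subsequence H.
  have [i [j [ij Rij]]] := wC _ (fun i => Cs (phi i)).
  by case: (Ht i (phi j) (mono _ _ ij)).
have next n : exists m, N <= n -> n < m /\ R (s n) (s m).
  have [Nn|nN] := leqP N n; last by exists 0.
  apply: NNPP => no; apply: HN; exists n => // m nm Rnm.
  by apply: no; exists m.
have [g Hg] := choice _ next.
have HN' i : N <= iter i g N.
  by elim: i => //= i IH; apply: leq_trans (ltnW (proj1 (Hg _ IH))).
exists (fun i => iter i g N) => i j ij.
apply: (homo_ltn (f := fun i => iter i g N) (r := fun a b => a < b /\ R (s a)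
  (s b))) => [|k|//].
  2: exact: Hg.
by move=> b a c [ab Rab] [bc Rbc]; split; [exact: ltn_trans bc|exact: R_trans
  Rbc].
Qed.

End WellQuasiOrder.

Lemma wqo_prod (T1 T2 : Type) (R1 : T1 -> T1 -> Prop) (R2 : T2 -> T2 -> Prop)
    (C1 : T1 -> Prop) (C2 : T2 -> Prop) :
  (forall y x z, R1 x y -> R1 y z -> R1 x z) ->
  well_quasi_ordered C1 R1 -> well_quasi_ordered C2 R2 ->
  well_quasi_ordered (fun x => C1 x.1 /\ C2 x.2)
    (fun x y => R1 x.1 y.1 /\ R2 x.2 y.2).
Proof.
move=> R1_trans w1 w2 s Hs.
have [phi Hphi] := wqo_chain (s := fun i => (s i).1) R1_trans w1 (fun i =>
  proj1 (Hs i)).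
have [i [j [ij Rij]]] := w2 (fun i => (s (phi i)).2) (fun i => proj2 (Hs (phi
  i))).
by exists (phi i), (phi j); have [] := Hphi _ _ ij.
Qed.

Lemma wqo_fin (T : finType) (C : T -> Prop) : well_quasi_ordered C eq.
Proof.
move=> s _; pose f (i : 'I_#|T|.+1) := s i.
have /injectivePn[i [j ij E]] : ~~ injectiveb f.
  apply/negP => /injectiveP/leq_card; rewrite card_ord ltnn //.
have [ltij|ltji|/val_inj eqij] := ltngtP i j.
- by exists i, j.
- by exists j, i.
- by rewrite eqij eqxx in ij.
Qed.

Section MinimalBadSequence.
Variables (T : Type) (C : T -> Prop) (R part : T -> T -> Prop) (size : T ->
  nat).
Hypothesis R_trans : forall y x z, R x y -> R y z -> R x z.
Hypothesis partP :
  forall x y, C y -> part x y -> [/\ C x, R x y & size x < size y].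

Let bad (s : nat -> T) :=
  (forall i, C (s i)) /\ forall i j, i < j -> ~ R (s i) (s j).

Let agree n (s t : nat -> T) := forall i, i < n -> s i = t i.

Let bad_min_at n s : bad s -> exists t, [/\ bad t, agree n s t &
  forall u, bad u -> agree n s u -> size (t n) <= size (u n)].
Proof.
move=> bs; have [k lek] := ubnP (size (s n)); elim: k => // k IH in s bs lek *.
have [[u [bu su ltu]]|no] := classic (exists u, [/\ bad u, agree n s u & size
  (u n) < size (s n)]).
  have [|t [bt ut tmin]] := IH u bu; first exact: leq_trans ltu _.
  exists t; split=> // [i ltin|v bv sv]; first by rewrite su // ut.
  by apply: tmin => // i ltin; rewrite -su // sv.
exists s; split=> // u bu su; rewrite leqNgt; apply/negP => ltu.
by apply: no; exists u.
Qed.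

Lemma minimal_bad_sequence s : bad s ->
  exists2 d, bad d & forall n u, bad u -> agree n d u ->
  size (d n) <= size (u n).
Proof.
move=> bs; have /choice[next Hnext] : forall ns : nat * (nat -> T), exists t,
  bad ns.2 ->
    [/\ bad t, agree ns.1 ns.2 t &
     forall u, bad u -> agree ns.1 ns.2 u -> size (t ns.1) <= size (u ns.1)].
  move=> [n s'] /=; have [bs'|nb] := classic (bad s'); last by exists s'.
  by have [t Ht] := bad_min_at n bs'; exists t.
pose S := fix S n := if n is n'.+1 then next (n', S n') else s.
have bS n : bad (S n) by elim: n => //= n IH; case: (Hnext (n, S n) IH).
have SS n : agree n (S n) (S n.+1) by case: (Hnext (n, S n) (bS n)).
have SSk n k : agree n (S n) (S (n + k)).
  elim: k => [|k IH] i ltin; rewrite ?addn0 // addnS -SS ?IH //.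
  exact: leq_trans ltin (leq_addr _ _).
(* [S i.+1] minimizes entry [i], and later stages no longer change that entry. *)
pose d i := S i.+1 i.
have dS n : agree n d (S n).
  by move=> i ltin; have := SSk i.+1 (n - i.+1) i (ltnSn i); rewrite subnKC.
exists d.
  split=> [i|i j ij]; first exact: (proj1 (bS i.+1) i).
  by rewrite (dS j.+1 i) ?(dS j.+1 j) ?ltnS ?(ltnW ij) //;
    case: (bS j.+1) => _; apply.
move=> n u bu du; case: (Hnext (n, S n) (bS n)) => _ _; apply=> // i ltin.
by rewrite /= -(dS n i ltin); apply: du.
Qed.

(** The hypothesis is used for a minimal bad sequence: its parts are well-quasi-ordered, since a bad
    sequence of parts could be spliced into it to give a smaller bad sequence. *)
Lemma nash_williams :
  (forall s, (forall i, C (s i)) ->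
     well_quasi_ordered (fun x => exists i, part x (s i)) R ->
     exists i j, i < j /\ R (s i) (s j)) ->
  well_quasi_ordered C R.
Proof.
move=> H s Cs; apply: NNPP => no.
have [|d [Cd nd] dmin] := @minimal_bad_sequence s.
  by split=> // i j ij Rij; apply: no; exists i, j.
have [|i [j [ij Rij]]] := H d Cd; last exact: nd Rij.
move=> q Hq; apply: NNPP => noq.
have [f Hf] := choice _ Hq.
(* The splice keeps the first [m] entries of [d], with [m] the least index of a member having some
   [q j] as a part. Then [d i] below [q j] with [i < m] would put [d i] below [d (f j)], a later
   entry as [m <= f j]. *)
have [k [m kmin]] : exists k, exists m, f k = m /\ forall j, m <= f j.
  have: exists k, exists j, f j = k by exists (f 0), 0.
  move=> [n [j0 Hj0]]; elim/ltn_ind: n j0 Hj0 => n IH j0 Hj0.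
  have [[j1 lt1]|no1] := classic (exists j1, f j1 < n);
    first exact: IH lt1 j1 erefl.
  exists j0, n; split=> // j1; rewrite leqNgt; apply/negP => lt1.
  by apply: no1; exists j1.
have [fk mf] := kmin.
pose t i := if i < m then d i else q (k + (i - m)).
have [Cq Rq sq] : [/\ forall i, C (q i), forall i, R (q i) (d (f i)) & forall
  i, size (q i) < size (d (f i))].
  by split=> i; case: (partP (Cd _) (Hf i)).
suff bt : bad t.
  have := dmin m t bt; rewrite {2}/t ltnn subnn addn0 leqNgt -{2}fk sq.
  by move=> /(_ _)/negP[] // i lti; rewrite /t lti.
split=> [i|i j ij]; rewrite /t; first by case: ifP.
have [im|im] := ltnP i m; have [jm|jm] := ltnP j m.
- exact: nd.
- move=> Rij; apply: (nd i (f (k + (j - m)))); first exact: leq_trans im _.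
  exact: R_trans (Rq _).
- by have := leq_ltn_trans im (ltn_trans ij jm); rewrite ltnn.
move=> Rij; apply: noq; exists (k + (i - m)), (k + (j - m)); split=> //.
by rewrite ltn_add2l ltn_sub2rE.
Qed.

End MinimalBadSequence.

(** * Contractions of multiplicity functions *)

Lemma fiberP (V W : finType) (A : {set V}) (f : V -> W) (b : W) x :
  reflect (x \in A /\ f x = b) (x \in fiber A f b).
Proof. by rewrite inE; apply: (iffP andP) => -[xA /eqP]. Qed.

Lemma sum_fibers (V W : finType) (A : {set V}) (f : V -> W)
    (Z : {set W}) (h : V -> nat) :
  \sum_(z in Z) \sum_(x in fiber A f z) h x = \sum_(x in pullback A f Z) h x.
Proof.
rewrite [RHS](partition_big f (mem Z)) /= => [|x];
  last by rewrite inE => /andP[].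
apply: eq_bigr => z zZ; apply: eq_bigl => x; rewrite !inE.
by have [->|] := eqVneq (f x) z; rewrite ?zZ ?andbT ?andbF.
Qed.

Section Contracts.
Variables (V' V : finType) (m' : V' -> V' -> nat) (m : V -> V -> nat).
Variables (A' : {set V'}) (A : {set V}) (f : V' -> V).

(* The diagonals of m and m' are irrelevant: loops are ignored throughout. *)
Definition contracts :=
  [/\ forall x', x' \in A' -> f x' \in A,
      forall x, x \in A -> conn m' (fiber A' f x)
    & forall x y, x \in A -> y \in A -> x != y ->
        m x y = ecount m' (fiber A' f x) (fiber A' f y)].

Hypothesis m'_sym : forall x y, m' x y = m' y x.
Hypothesis cf : contracts.

Lemma contracts_conn (Z : {set V}) : Z \subset A -> conn m Z -> conn m'
  (pullback A' f Z).
Proof.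
move=> /subsetP ZA cZ; have [fA fc fm] := cf.
have [->|[w]] := set_0Vmem (pullback A' f Z); first exact: conn0.
move=> wL; have := wL; rewrite inE => /andP[wA' wZ].
apply: (connI m'_sym wL) => U y yL yU wU.
have := yL; rewrite inE => /andP[yA' yZ].
have inL z u : z \in Z -> u \in fiber A' f z -> u \in pullback A' f Z.
  by move=> zZ /fiberP[uA' fu]; rewrite inE uA' fu.
have split_fiber z u v : z \in Z -> u \in fiber A' f z -> u \in U ->
    v \in fiber A' f z -> v \notin U -> exists u v,
    [/\ u \in pullback A' f Z, u \in U, v \in pullback A' f Z, v \notin U & 0 <
      m' u v].
  move=> zZ uF uU vF vU.
  have [u1 [v1 [u1F u1U v1F v1U uv]]] := conn_cross (fc z (ZA _ zZ)) uF uU vF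
    vU.
  by exists u1, v1; split=> //; apply: inL zZ _.
pose U' := [set z | [exists u in fiber A' f z, u \in U]].
have [fwU|fwU] := boolP (f w \in U').
  move: fwU; rewrite inE => /exists_inP[u uF uU].
  by apply: (split_fiber (f w) u w) => //; apply/fiberP.
have fyU : f y \in U' by rewrite inE; apply/exists_inP; exists y => //;
  apply/fiberP.
have [z1 [z2 [z1Z z1U z2Z z2U z12]]] := conn_cross cZ yZ fyU wZ fwU.
have nz : z1 != z2 by apply: contraTneq z1U => ->.
move: z12; rewrite (fm _ _ (ZA _ z1Z) (ZA _ z2Z) nz) ecount_gt0 => /touchP[u [v
  [uF vF uv]]].
have vU : v \notin U.
  by apply: contra z2U => vU; rewrite inE; apply/exists_inP; exists v.
have [uU|uU] := boolP (u \in U).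
  by exists u, v; split=> //; apply: inL; [exact: z1Z| |exact: z2Z|].
move: z1U; rewrite inE => /exists_inP[u' u'F u'U].
exact: split_fiber z1Z u'F u'U uF uU.
Qed.

Lemma contracts_ecount (X Y : {set V}) : X \subset A -> Y \subset A ->
  [disjoint X & Y] ->
  ecount m X Y = ecount m' (pullback A' f X) (pullback A' f Y).
Proof.
move=> /subsetP XA /subsetP YA dXY; have [_ _ fm] := cf.
rewrite {2}/ecount -sum_fibers; apply: eq_bigr => x xX.
under [RHS]eq_bigr do rewrite -sum_fibers.
rewrite exchange_big /=; apply: eq_bigr => y yY.
rewrite (fm x y (XA x xX) (YA y yY)) //.
by apply: contraTneq xX => ->; rewrite (disjointFl dXY).
Qed.

End Contracts.

Lemma contracts_comp (V'' V' V : finType) m'' m' m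
    (A'' : {set V''}) (A' : {set V'})
    (A : {set V}) f g :
  (forall x y, m'' x y = m'' y x) ->
  contracts m'' m' A'' A' f -> contracts m' m A' A g ->
  contracts m'' m A'' A (g \o f).
Proof.
move=> m''_sym cf cg; have [fA _ _] := cf; have [gA gc gm] := cg.
have fibE x : fiber A'' (g \o f) x = pullback A'' f (fiber A' g x).
  apply/setP=> u; rewrite !inE /=.
  by have [/fA ->|//] := boolP (u \in A'').
have FA x : fiber A' g x \subset A' by apply/subsetP => u /fiberP[].
split=> [x /fA/gA //|x xA|x y xA yA xy].
  by rewrite fibE; apply: (contracts_conn m''_sym cf (FA x)); apply: gc.
rewrite gm // !fibE; apply: (contracts_ecount cf (FA x) (FA y)).
rewrite -setI_eq0; apply/eqP/setP => u; rewrite !inE.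
by apply/negP => /andP[/andP[_ /eqP ux] /andP[_ /eqP uy]];
  rewrite -ux -uy eqxx in xy.
Qed.

Lemma fiber_id (V : finType) (A : {set V}) x : x \in A ->
  fiber A id x = [set x].
Proof. by move=> xA; apply/setP=> y; rewrite !inE; case: eqP => [->|];
  rewrite ?xA ?andbF. Qed.

Lemma contracts_id (V : finType) m (A : {set V}) : contracts m m A A id.
Proof.
split=> // [x xA|x y xA yA _]; rewrite !fiber_id //.
  apply/forallP => U; have [xU|xU] := boolP (x \in U); apply/or3P.
    by constructor 2; rewrite setD_eq0 sub1set.
  by constructor 1; rewrite setI_eq0 disjoints1.
by rewrite /ecount !big_set1.
Qed.

(** Everything outside the part is contracted into [b]. No multiplicity inside the part changes,
    because only [b] has neighbours outside. *)
Lemma contracts_fiber (V : finType) m (A B : {set V}) pi b :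
  (forall x y, m x y = m y x) -> conn m A -> retraction m A B pi -> b \in B ->
  contracts m m A (fiber A pi b) (fun x => if x \in fiber A pi b then x else b).
Proof.
move=> m_sym cA retr bB; have bF := mem_fiber retr bB.
set F := fiber A pi b in bF *; pose f x := if x \in F then x else b.
have FA : F \subset A by apply/subsetP => x /fiberP[].
have fib1 x : x \in F -> x != b -> fiber A f x = [set x].
  move=> xF xb; apply/setP => y; rewrite !inE /f.
  have [yF|yF] := boolP (y \in F); first by case: eqP => [->|];
    rewrite ?(subsetP FA) ?andbF.
  by rewrite (eq_sym b) (negPf xb) andbF; apply/esym/negbTE;
    apply: contraNneq yF => ->.
have fibb : fiber A f b = A :\: (F :\ b).
  apply/setP => y; rewrite [LHS]inE in_setD in_setD1 andbC /f.
  by have [yF|yF] := boolP (y \in F); rewrite ?eqxx ?andbT ?andbF ?negbK.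
split=> [x xA|x xF|x y xF yF xy].
- by rewrite /f; case: ifP.
- have [->|xb] := eqVneq x b; last by rewrite fib1 //; apply: conn1.
  by rewrite fibb; apply: compl_fiber_conn retr cA _ bB.
have one z : z \in F -> z \in fiber A f z.
  by move=> zF; apply/fiberP; rewrite /f zF (subsetP FA).
have noadj z u : z \in F -> z != b -> u \in fiber A f b -> 0 < m z u -> u = b.
  move=> zF zb; rewrite fibb => /setDP[uA uF'] zu; apply/eqP.
  apply: contraR zb => ub; apply/eqP; apply: (proj1 (fiber_exit retr zF uA _
    zu)).
  by move: uF'; rewrite !inE ub.
have -> : m x y = ecount m [set x] [set y] by rewrite /ecount !big_set1.
apply/esym/ecountS; rewrite ?sub1set ?one // => u v.
have [xb|xb] := eqVneq x b.
  subst x; rewrite eq_sym in xy; rewrite (fib1 y yF xy) => ub;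
    rewrite inE => /eqP -> uy.
  rewrite m_sym in uy.
  by rewrite (noadj y u yF xy ub uy) ?inE !eqxx.
rewrite (fib1 x xF xb) inE => /eqP->; have [->|yb] := eqVneq y b.
  by move=> vb xv; rewrite (noadj x v xF xb vb xv) ?inE !eqxx.
by rewrite (fib1 y yF yb) => -> _; rewrite ?inE eqxx.
Qed.

(* Given f contracting B' to B, each b in B has a chosen c b over it, whose hanging
   part is contracted by g b to the part at b; the parts hanging off the other
   vertices over b are contracted into b. *)
Section BlockContracts.
Variables (V' V : finType) (m' : V' -> V' -> nat) (m : V -> V -> nat).
Variables (A' B' : {set V'}) (A B : {set V}) (pi' : V' -> V') (pi : V -> V).
Variables (f : V' -> V) (c : V -> V') (g : V -> V' -> V).
Hypotheses (m'_sym : forall x y, m' x y = m' y x).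
Hypotheses (cA' : conn m' A') (retr' : retraction m' A' B' pi').
Hypotheses (retr : retraction m A B pi).
Hypotheses (cf : contracts m' m B' B f) (cP : forall b, b \in B -> c b \in
  fiber B' f b).
Hypothesis cg : forall b, b \in B ->
  contracts m' m (fiber A' pi' (c b)) (fiber A pi b) (g b) /\ g b (c b) = b.

Definition block_map x' :=
  if pi' x' == c (f (pi' x')) then g (f (pi' x')) x' else f (pi' x').

Lemma block_map_block x' : x' \in B' -> block_map x' = f x'.
Proof.
case: retr' => _ _ piB' _ xB; rewrite /block_map piB' //; case: eqP => // E.
by have [fB _ _] := cf; rewrite {2}E; case: (cg (fB _ xB)).
Qed.

Lemma retr_block_map x' : x' \in A' -> pi (block_map x') = f (pi' x').
Proof.
have [_ piAB' _ _] := retr'; have [_ _ piB _] := retr; have [fB _ _] := cf.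
move=> xA; have bB := fB _ (piAB' _ xA); rewrite /block_map.
case: eqP => [E|_]; last exact: piB.
have [[gF _ _] _] := cg bB; have : x' \in fiber A' pi' (c (f (pi' x'))) by
  apply/fiberP.
by move/gF => /fiberP[].
Qed.

Lemma block_map_in x' : x' \in A' -> block_map x' \in A.
Proof.
have [_ piAB' _ _] := retr'; have [/subsetP BA _ _ _] := retr;
  have [fB _ _] := cf.
move=> xA; have bB := fB _ (piAB' _ xA); rewrite /block_map.
case: eqP => [E|_]; last exact: BA.
have [[gF _ _] _] := cg bB; have : x' \in fiber A' pi' (c (f (pi' x'))) by
  apply/fiberP.
by move/gF => /fiberP[].
Qed.

Lemma block_map_chosen b x' : b \in B -> x' \in fiber A' pi' (c b) ->
  block_map x' = g b x'.
Proof.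
by move=> bB /fiberP[_ E]; rewrite /block_map E; have /fiberP[_ ->] := cP bB;
  rewrite eqxx.
Qed.

Lemma fiber_block_map x b : b \in B -> x \in fiber A pi b ->
  fiber (fiber A' pi' (c b)) (g b) x \subset fiber A' block_map x.
Proof.
move=> bB xF; apply/subsetP => u /fiberP[uF gu]; apply/fiberP.
by rewrite (block_map_chosen bB uF); case/fiberP: uF.
Qed.

Lemma fiber_block_mapP x x' : x \in A -> x' \in fiber A' block_map x ->
  x' \in fiber (fiber A' pi' (c (pi x))) (g (pi x)) x \/ x = pi x.
Proof.
move=> xA /fiberP[xA' hx]; have E := retr_block_map xA'; rewrite hx in E.
move: hx; rewrite /block_map -E; case: eqP => [pE gx|_ px].
  by left; apply/fiberP; split=> //; apply/fiberP.
by right.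
Qed.

Lemma conn_fiber_block_map x : x \in A -> conn m' (fiber A' block_map x).
Proof.
move=> xA; have [/subsetP BA piAB piB piE] := retr;
  have [/subsetP BA' piAB' piB' piE'] := retr'.
have bB := piAB x xA; have xF : x \in fiber A pi (pi x) by apply/fiberP.
have [[gF gc gm] gcb] := cg bB; have [fB fc fm] := cf.
have [xE|xE] := eqVneq x (pi x); last first.
  suff -> : fiber A' block_map x = fiber (fiber A' pi' (c (pi x))) (g (pi x)) x
    by apply: gc.
  apply/eqP; rewrite eqEsubset fiber_block_map // andbT; apply/subsetP => u uF.
  by case: (fiber_block_mapP xA uF) => // E; rewrite -E eqxx in xE.
move: bB xF gF gc gm gcb; rewrite -xE {xE xA} => xB xF gF gc gm gcb.
apply: (@conn_bigcup _ m' _ (fiber B' f x)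
  (fun b' => if b' == c x then fiber (fiber A' pi' (c x)) (g x) x else fiber A'
    pi' b')).
- exact: fc.
- apply/subsetP => u /fiberP[uB fu]; apply/fiberP; split; first exact: BA'.
  by rewrite block_map_block.
- move=> b' /fiberP[bB' fb]; case: eqP => [->|bn]; split.
  + exact: gc.
  + apply/fiberP; split=> //; apply: (mem_fiber retr').
    by have /fiberP[] := cP xB.
  + exact: fiber_block_map.
  + exact: (fiber_conn m'_sym retr' cA' bB').
  + exact: (mem_fiber retr' bB').
  + apply/subsetP=> u /fiberP[uA pu]; apply/fiberP; split=> //.
    by rewrite /block_map pu fb; case: eqP.
move=> u uF; have /fiberP[uA hu] := uF; have E := retr_block_map uA.
rewrite hu piB // in E; exists (pi' u); first by apply/fiberP; rewrite piAB'.
move: hu; rewrite /block_map -E; case: eqP => [pE hu|_ _]; last exact/fiberP.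
by apply/fiberP; split=> //; apply/fiberP.
Qed.

Lemma contracts_block : contracts m' m A' A block_map.
Proof.
split; [exact: block_map_in|exact: conn_fiber_block_map|move=> x y xA yA xy].
have [/subsetP BA piAB piB piE] := retr; have [/subsetP BA' piAB' piB' piE'] :=
  retr'.
have [fB fc fm] := cf.
have BfS z : fiber B' f z \subset fiber A' block_map z.
  by apply/subsetP => u /fiberP[uB fu]; apply/fiberP;
    rewrite BA' // block_map_block.
(* An edge of [A'] stays within one hanging part or lies in [B']. So the edges over a pair [x], [y]
   are counted by [g] if both belong to the same part, and otherwise by [f]. *)
have edge u v : u \in fiber A' block_map x -> v \in fiber A' block_map y -> 0 <
  m' u v ->
    pi' u = pi' v \/ [/\ u \in fiber B' f x, v \in fiber B' f y, x \in B & y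
      \in B].
  move=> /fiberP[uA hu] /fiberP[vA hv] uv; case: (piE' u v uA vA uv) => [|[uB
    vB]]; first by left.
  right; rewrite block_map_block // in hu; rewrite block_map_block // in hv.
  by rewrite -hu -hv !fB //; split=> //; apply/fiberP.
have [pxy|pxy] := eqVneq (pi x) (pi y).
  have bB := piAB x xA; have [[gF gc gm] gcb] := cg bB.
  have xF : x \in fiber A pi (pi x) by apply/fiberP.
  have yF : y \in fiber A pi (pi x) by apply/fiberP.
  rewrite (gm x y) //; apply/esym/ecountS; try exact: fiber_block_map.
  move=> u v uF vF uv; have [puv|[_ _ xB yB]] := edge u v uF vF uv; last first.
    by rewrite -(piB x) // -(piB y) // pxy eqxx in xy.
  have [uF'|xE] := fiber_block_mapP xA uF; have [vF'|yE] := fiber_block_mapP yA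
    vF.
  - by rewrite uF' pxy.
  - rewrite uF' /=; have /fiberP[vA hv] := vF; have /fiberP[/fiberP[uA pu] gu]
      := uF'.
    have vF' : v \in fiber A' pi' (c (pi x)) by apply/fiberP; rewrite -puv.
    by apply/fiberP; rewrite -(block_map_chosen bB vF').
  - rewrite pxy vF' andbT; have /fiberP[uA hu] := uF;
      have /fiberP[/fiberP[vA pv] gv] := vF'.
    rewrite -pxy in pv *.
    have uF' : u \in fiber A' pi' (c (pi x)) by apply/fiberP; rewrite puv.
    by apply/fiberP; rewrite -(block_map_chosen bB uF').
  - by rewrite xE yE pxy eqxx in xy.
have noEq u v : u \in fiber A' block_map x -> v \in fiber A' block_map y -> pi'
  u != pi' v.
  move=> /fiberP[uA hu] /fiberP[vA hv]; apply: contraNneq pxy => E.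
  by rewrite -hu -hv !retr_block_map // E.
have [/andP[xB yB]|xyB] := boolP ((x \in B) && (y \in B)).
  rewrite fm //; apply/esym/ecountS => // u v uF vF uv.
  case: (edge u v uF vF uv) => [E|[-> ->] //].
  by have := noEq u v uF vF; rewrite E eqxx.
rewrite ecount_eq0.
  apply/eqP; rewrite -leqn0 leqNgt; apply/negP => mxy.
  case: (piE x y xA yA mxy) => [E|[xB yB]]; first by rewrite E eqxx in pxy.
  by rewrite xB yB in xyB.
apply/touchP => -[u [v [uF vF uv]]].
case: (edge u v uF vF uv) => [E|[_ _ xB yB]]; last by rewrite xB yB in xyB.
by have := noEq u v uF vF; rewrite E eqxx.
Qed.

End BlockContracts.

(** * Numbered bond edges and gluing two sides along a bond *)

Definition joins n (V : finType) (m : V -> V -> nat)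
    (X Y : {set V}) (a b : 'I_n -> V) :=
  [/\ forall i, a i \in X, forall i, b i \in Y
    & forall x y, x \in X -> y \in Y ->
    m x y = #|[set i | (a i == x) && (b i == y)]|].

Lemma joins_ex (V : finType) (m : V -> V -> nat) (X Y : {set V}) :
  exists a b : 'I_(ecount m X Y) -> V, joins m X Y a b.
Proof.
pose s := flatten [seq nseq (m p.1 p.2) p | p <- enum (setX X Y)].
have sS : size s = ecount m X Y.
  rewrite size_flatten /shape -map_comp sumnE big_map big_enum /=.
  rewrite /ecount pair_big_dep /=; apply: eq_big => [[x y]|[x y] _] /=.
    by rewrite inE.
  by rewrite size_nseq.
have sXY p : p \in s -> p \in setX X Y.
  by move=> /flattenP[_ /mapP[q qXY ->]] /nseqP[-> _]; rewrite mem_enum in qXY.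
have sC x y : x \in X -> y \in Y -> count_mem (x, y) s = m x y.
  move=> xX yY; rewrite count_flatten -map_comp sumnE big_map big_enum /=.
  rewrite (bigD1 (x, y)) ?inE ?xX ?yY //= count_nseq /= eqxx mul1n big1 ?addn0
    // => q /andP[_ qn].
  by rewrite count_nseq /= (negPf qn).
pose t := tcast sS (in_tuple s).
have tE : tval t = s by rewrite val_tcast.
have tP i : tnth t i \in setX X Y by apply: sXY; rewrite -tE mem_tnth.
exists (fun i => (tnth t i).1), (fun i => (tnth t i).2); split.
- by move=> i; have := tP i; rewrite inE => /andP[].
- by move=> i; have := tP i; rewrite inE => /andP[].
move=> x y xX yY; rewrite -(sC x y xX yY) -tE -[in LHS](map_tnth_enum t)
  count_map.
rewrite -sum1_count -sum1_card big_enum_cond; apply: eq_bigl => i.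
by rewrite inE /= -pair_eqE; case: (tnth t i).
Qed.

(* X and Y are the two sides of a bond whose n edges are a i -- b i. *)
Section Glue.
Variables (n : nat) (V' V : finType) (m' : V' -> V' -> nat) (m : V -> V -> nat).
Variables (X' Y' : {set V'}) (X Y : {set V}) (f g : V' -> V).
Variables (a' b' : 'I_n -> V') (a b : 'I_n -> V).
Hypotheses (m'_sym : forall x y, m' x y = m' y x) (m_sym : forall x y, m x y =
  m y x).
Hypotheses (dXY' : [disjoint X' & Y']) (dXY : [disjoint X & Y]).
Hypotheses (cf : contracts m' m X' X f) (cg : contracts m' m Y' Y g).
Hypotheses (J' : joins m' X' Y' a' b') (J : joins m X Y a b).
Hypotheses (fa : forall i, f (a' i) = a i) (gb : forall i, g (b' i) = b i).

Definition glue x' := if x' \in X' then f x' else g x'.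

Lemma fiber_gluel x : x \in X -> fiber (X' :|: Y') glue x = fiber X' f x.
Proof.
move=> xX; apply/setP=> u; rewrite !inE /glue; have [//|uX /=] := boolP (u \in
  X').
have [uY /=|//] := boolP (u \in Y'); apply: contraTF xX => /eqP <-.
by case: cg => gY _ _; rewrite (disjointFl dXY (gY _ uY)).
Qed.

Lemma fiber_gluer y : y \in Y -> fiber (X' :|: Y') glue y = fiber Y' g y.
Proof.
move=> yY; apply/setP=> u; rewrite !inE /glue; have [uX /=|//] := boolP (u \in
  X').
rewrite (disjointFr dXY' uX) /=; apply: contraTF yY => /eqP <-.
by case: cf => fX _ _; rewrite (disjointFr dXY (fX _ uX)).
Qed.

Lemma contracts_glue : contracts m' m (X' :|: Y') (X :|: Y) glue.
Proof.
have [fX fc fm] := cf; have [gY gc gm] := cg.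
have [aX' bY' m'E] := J'; have [aX bY mE] := J.
(* The numbers carry the count: edge [i] of the first graph is mapped onto edge [i] of the second,
   so the indices giving [x] and [y] are sorted by their ends upstairs. *)
have cross x y : x \in X -> y \in Y -> m x y = ecount m' (fiber X' f x) (fiber
  Y' g y).
  move=> xX yY; rewrite mE // -sum1_card (partition_big a' (mem (fiber X' f
    x))) /=.
    apply: eq_bigr => u uF; rewrite (partition_big b' (mem (fiber Y' g y))) /=.
      apply: eq_bigr => v vF; have /fiberP[uX fu] := uF;
        have /fiberP[vY gv] := vF.
      rewrite m'E // -sum1_card; apply: eq_bigl => i; rewrite !inE.
      have [au|] := eqVneq (a' i) u; last by rewrite !andbF.
      have [bv|] := eqVneq (b' i) v; last by rewrite !andbF.
      by rewrite -fa -gb au bv fu gv !eqxx.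
    move=> i; rewrite inE => /andP[/andP[_ /eqP bi] _].
    by apply/fiberP; rewrite gb.
  move=> i; rewrite inE => /andP[/eqP ai _].
  by apply/fiberP; rewrite fa.
split.
- move=> u; rewrite in_setU /glue; case: ifP => [uX _|_ uY];
    first by rewrite in_setU fX.
  by rewrite in_setU gY ?orbT.
- move=> x /setUP[xX|xY]; first by rewrite fiber_gluel //; apply: fc.
  by rewrite fiber_gluer //; apply: gc.
move=> x y /setUP[xX|xY] /setUP[yX|yY] xy.
- by rewrite !fiber_gluel // fm.
- by rewrite fiber_gluel // fiber_gluer // cross.
- by rewrite m_sym (fiber_gluel yX) (fiber_gluer xY) cross // ecount_sym.
- by rewrite !fiber_gluer // gm.
Qed.

End Glue.

(** * Labelled rooted graphs *)

(** Having [carrier] as a subset of an ambient type lets sides, blocks and hanging parts share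
    vertices and multiplicities with the whole graph. *)
Record lgraph (Q : Type) := LGraph {
  rvert : finType;
  mult : rvert -> rvert -> nat;
  mult_sym : forall x y, mult x y = mult y x;
  carrier : {set rvert};
  label : rvert -> Q;
  lroot : rvert }.

Section LabelledContraction.
Variables (Q : Type) (le : Q -> Q -> Prop).

(** [contracts] alone tolerates empty fibers, as the empty set is [conn]; the label condition
    excludes them. *)
Definition rcontracts (g g' : lgraph Q) (f : rvert g' -> rvert g) :=
  [/\ contracts (@mult Q g') (@mult Q g) (carrier g') (carrier g) f,
      f (lroot g') = lroot g
    & forall x, x \in carrier g -> exists2 x', x' \in fiber (carrier g') f x
        & le (label x) (label x')].

Definition rle (g g' : lgraph Q) := exists f, @rcontracts g g' f.

Definition rgood (C : Q -> Prop) k (g : lgraph Q) :=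
  [/\ lroot g \in carrier g, conn (@mult Q g) (carrier g),
      bonds_le (@mult Q g) k (carrier g)
    & forall x, x \in carrier g -> C (label x)].

Hypothesis le_refl : forall x, le x x.
Hypothesis le_trans : forall y x z, le x y -> le y z -> le x z.

Lemma rle_refl g : rle g g.
Proof.
exists id; split=> //; first exact: contracts_id.
by move=> x xA; exists x => //; rewrite fiber_id ?inE.
Qed.

Lemma rle_trans g2 g1 g3 : rle g1 g2 -> rle g2 g3 -> rle g1 g3.
Proof.
move=> [f [cf rf lf]] [h [ch rh lh]]; exists (f \o h); split.
- exact: contracts_comp (@mult_sym _ g3) ch cf.
- by rewrite /= rh rf.
move=> x xA; have [y /fiberP[yA yx] lxy] := lf x xA.
have [z /fiberP[zA zy] lyz] := lh y yA.
exists z; first by apply/fiberP; rewrite /= zy.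
exact: le_trans lxy lyz.
Qed.

Definition fiber_part (g : lgraph Q) (pi : rvert g -> rvert g) b :=
  LGraph (@mult_sym _ g) (fiber (carrier g) pi b) (@label _ g) b.

(** With the root in [B], contracting the rest of [g] into [b] sends the root of [g] to that of the
    part; with two vertices in [B], the part is strictly smaller than [g]. *)
Definition part (h g : lgraph Q) := exists B pi b,
  [/\ retraction (@mult _ g) (carrier g) B pi, lroot g \in B, 1 < #|B|, b \in B
    & h = fiber_part pi b].

Lemma partP C k h g : rgood C k g -> part h g ->
  [/\ rgood C k h, rle h g & #|carrier h| < #|carrier g|].
Proof.
move=> [rA cA bA CA] [B [pi [b [retr rB B1 bB ->]]]]; split;
  last exact: (card_fiber retr B1 bB).
  split=> /=.
  - exact: (mem_fiber retr bB).
  - exact: (fiber_conn (@mult_sym _ g) retr cA bB).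
  - exact: (bonds_le_fiber (@mult_sym _ g) retr cA bB bA).
  - by move=> x /fiberP[xA _]; apply: CA.
exists (fun x => if x \in fiber (carrier g) pi b then x else b); split.
- exact: (contracts_fiber (@mult_sym _ g) cA retr bB).
- by case: ifP => // /fiberP[_]; case: retr => _ _ ->.
move=> x /= xF; exists x => //; apply/fiberP; rewrite xF.
by case/fiberP: xF.
Qed.

Lemma wqo_singletons (C : Q -> Prop) : well_quasi_ordered C le ->
  well_quasi_ordered
    (fun g => C (label (lroot g)) /\ carrier g = [set lroot g]) rle.
Proof.
move=> wC; apply: (wqo_reflect (D := fun g q => q = label (lroot g)) wC).
  by move=> g [Cg _]; exists (label (lroot g)).
move=> g q g' q' [_ gA] [_ gA'] -> -> lgg'; exists (fun _ => lroot g).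
have fibE x : x \in carrier g -> fiber (carrier g') (fun=> lroot g) x = [set
  lroot g'].
  by rewrite gA inE => /eqP->; rewrite gA'; apply/setP => y;
    rewrite !inE eqxx andbT.
split=> //; last first.
  by move=> x xA; exists (lroot g'); rewrite ?fibE ?inE //; move: xA;
    rewrite gA inE => /eqP->.
split=> [x _|x xA|x y].
- by rewrite gA inE.
- by rewrite fibE //; apply: conn1; apply: mult_sym.
by rewrite gA !inE => /eqP-> /eqP->; rewrite eqxx.
Qed.

End LabelledContraction.

(** All label orders are quantified because the induction changes them: sides of a bond carry labels
    in [Q * {set 'I_k.+1}], blocks carry labels in [lgraph Q]. The predicate [C] restricts the
    latter to the parts of one fixed sequence. *)
Definition rooted_wqo (P : forall Q : Type, lgraph Q -> Prop) k :=
  forall (Q : Type) (le : Q -> Q -> Prop) (C : Q -> Prop),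
    (forall x, le x x) -> (forall y x z, le x y -> le y z -> le x z) ->
    well_quasi_ordered C le ->
    well_quasi_ordered (fun g => rgood C k g /\ P Q g) (rle le).

Definition any_graph (Q : Type) (g : lgraph Q) := True.

Definition block_graph (Q : Type) (g : lgraph Q) :=
  nocut (@mult _ g) (carrier g).

(** Only one-vertex graphs remain: a component of the carrier minus the root would be the side of a
    bond with at least one edge. *)
Lemma rooted_wqo0 : rooted_wqo any_graph 0.
Proof.
move=> Q le C le_refl le_trans wC; apply: wqoS (wqo_singletons wC) => g [[rA cA
  bA CA] _].
split; first exact: CA.
apply/eqP; rewrite eqEsubset sub1set rA andbT; apply/subsetP => x xA;
  rewrite inE.
apply: contraT => xr.
have xD : [set x] \subset carrier g :\ lroot g by rewrite sub1set !inE xr.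
have [K compK xK] := component_ex (@mult_sym _ g) xD (conn1 (@mult_sym _ g) x)
  (set11 x).
have /and3P[cK KA _] := compK; rewrite sub1set in xK.
have rK : lroot g \notin K by apply/negP => /(subsetP KA); rewrite !inE eqxx.
have KA' := subset_trans KA (subsetDl _ _).
have : ecount (@mult _ g) K (carrier g :\: K) <= 0.
  apply: bA => //.
  - by apply/set0Pn; exists x.
  - by apply: contraNneq rK => ->.
  - exact: (conn_compl_component (@mult_sym _ g) cA rA compK).
rewrite leqn0 => /eqP E; have : 0 < ecount (@mult _ g) K (carrier g :\: K);
  last by rewrite E.
rewrite ecount_gt0; have [u [v [uA uK vA vK uv]]] := conn_cross cA xA xK rA rK.
by apply/touchP; exists u, v; rewrite inE vK.
Qed.

(** The second label component records which bond edges end at the vertex; [le'] below compares it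
    for equality. *)
Definition half n (Q : Type) (g : lgraph Q) (X : {set rvert g})
    (a : 'I_n -> rvert g) r :=
  LGraph (@mult_sym _ g) X (fun v => (label v, [set i | a i == v])) r.

Lemma wqo_blocks k : rooted_wqo any_graph k -> rooted_wqo block_graph k.+1.
Proof.
move=> IH Q le C le_refl le_trans wC.
pose split_block (g : lgraph Q) := exists X Y, [/\ carrier g = X :|: Y,
  [disjoint X & Y],
  lroot g \in X, Y != set0
  & [/\ conn (@mult _ g) X, conn (@mult _ g) Y & ecount (@mult _ g) X Y =
    k.+1]].
refine (wqoS (C := fun g => (rgood C k g /\ any_graph g) \/
    ((rgood C k.+1 g /\ block_graph g) /\ split_block g)) _ _).
  move=> g gg; have [[rA cA bA CA] ng] := gg.
  have [bk|nbk] := classic (bonds_le (@mult _ g) k (carrier g));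
    [by left|right].
  split=> //.
  have [X nX] := not_all_ex_not _ _ nbk.
  have [XA nX1] := imply_to_and _ _ nX; have [X0 nX2] := imply_to_and _ _ nX1.
  have [XnA nX3] := imply_to_and _ _ nX2; have [cX nX4] := imply_to_and _ _ nX3.
  have [cY /negP] := imply_to_and _ _ nX4; rewrite -ltnNge => kXY.
  have XY : ecount (@mult _ g) X (carrier g :\: X) = k.+1.
    by apply/eqP; rewrite eqn_leq kXY bA.
  have AE : carrier g = X :|: (carrier g :\: X) by rewrite -{1}(setID (carrier
    g) X) (setIidPr XA).
  have dXY : [disjoint X & carrier g :\: X] by rewrite disjoint_sym
    disjoints_subset subsetDr.
  have Y0 : carrier g :\: X != set0.
    by rewrite setD_eq0; apply: contra XnA => AX; rewrite eqEsubset XA.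
  have [rX|rX] := boolP (lroot g \in X); first by exists X, (carrier g :\: X).
  exists (carrier g :\: X), X; split=> //.
  - by rewrite setUC.
  - by rewrite disjoint_sym.
  - by rewrite inE rX.
  - by rewrite (ecount_sym (@mult_sym _ g)).
apply: wqoU; first exact: IH.
pose le' (p q : Q * {set 'I_k.+1}) := le p.1 q.1 /\ p.2 = q.2.
pose C' (p : Q * {set 'I_k.+1}) := C p.1 /\ True.
have le'_refl p : le' p p by [].
have le'_trans q p r : le' p q -> le' q r -> le' p r.
  by move=> [pq1 pq2] [qr1 qr2]; split; [exact: (le_trans _ _ _ pq1
    qr1)|rewrite pq2].
have wC' : well_quasi_ordered C' le'.
  refine (wqo_prod le_trans wC (@wqo_fin {set 'I_k.+1} (fun _ => True))).
have wh := IH _ _ _ le'_refl le'_trans wC'.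
pose D (g : lgraph Q) (p : lgraph (Q * {set 'I_k.+1}) * lgraph (Q * {set
  'I_k.+1})) :=
  exists X Y a b w, [/\ carrier g = X :|: Y, [disjoint X & Y], lroot g \in X,
    joins (@mult _ g) X Y a b & p = (half X a (lroot g), half Y b w)].
apply: (wqo_reflect (D := D) (wqo_prod (rle_trans le'_trans) wh wh)).
  move=> g [[[rA cA bA CA] ng] [X [Y [AE dXY rX Y0 [cX cY XY]]]]].
  (* The side without the root of [g] needs some root; any vertex will do. *)
  have [w wY] := set0Pn _ Y0.
  have := joins_ex (@mult _ g) X Y; rewrite XY => -[a [b J]].
  exists (half X a (lroot g), half Y b w); last by exists X, Y, a, b, w.
  split; split=> //; split=> //=.
  - exact: (bonds_le_side (@mult_sym _ g) ng bA AE dXY Y0 cX cY XY).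
  - by move=> x xX; split=> //; apply: CA; rewrite AE inE xX.
  - have X0 : X != set0 by apply/set0Pn; exists (lroot g).
    rewrite setUC in AE; rewrite disjoint_sym in dXY;
      rewrite (ecount_sym (@mult_sym _ g)) in XY.
    exact: (bonds_le_side (@mult_sym _ g) ng bA AE dXY X0 cY cX XY).
  - by move=> x xY; split=> //; apply: CA; rewrite AE inE xY orbT.
move=> g p g' p' _ _ [X [Y [a [b [w [AE dXY rX J ->]]]]]] [X' [Y' [a' [b' [w'
  [AE' dXY' rX' J' ->]]]]]].
move=> /= [[f [cf rf lf]] [h [ch rh lh]]]; rewrite /= in f cf rf lf h ch rh lh.
have [aX bY _] := J.
(* Some vertex over [a i] has the same index set as [a i], which contains [i]; that vertex must be
   [a' i]. *)
have fa i : f (a' i) = a i.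
  have [x' /fiberP[_ fx'] [_ /=]] := lf _ (aX i).
  by move=> /setP/(_ i); rewrite !inE eqxx => /esym/eqP->; rewrite fx'.
have hb i : h (b' i) = b i.
  have [x' /fiberP[_ fx'] [_ /=]] := lh _ (bY i).
  by move=> /setP/(_ i); rewrite !inE eqxx => /esym/eqP->; rewrite fx'.
exists (glue X' f h); split.
- rewrite AE AE'.
  exact: (contracts_glue (@mult_sym _ g') (@mult_sym _ g) dXY' dXY cf ch J' J
    fa hb).
- by rewrite /glue rX'.
- move=> x; rewrite AE AE' => /setUP[xX|xY].
    rewrite (fiber_gluel _ _ dXY ch xX).
    by have [x' x'F [lx _]] := lf x xX; exists x'.
  rewrite (fiber_gluer _ dXY' dXY cf xY).
  by have [x' x'F [lx _]] := lh x xY; exists x'.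
Qed.

Lemma wqo_rooted k : rooted_wqo block_graph k -> rooted_wqo any_graph k.
Proof.
move=> IH Q le C le_refl le_trans wC.
apply: (@wqoS _ _ (rgood C k)); first by move=> g [].
apply: (nash_williams (size := fun g => #|carrier g|) (rle_trans le_trans)).
  by move=> h g; apply: partP.
move=> s Cs wparts; set CP := (fun x => _) in wparts.
(* One-vertex graphs have no block with two vertices and are ordered by their label alone.
   Membership in [s] is kept so that the parts of [g] fall under [wparts]. *)
pose big (g : lgraph Q) := [/\ rgood C k g, 1 < #|carrier g| & exists i, g = s
  i].
suff wbig : well_quasi_ordered big (rle le).
  apply: (wqoU (wqo_singletons wC) wbig) => i; have [rA cA bA CA] := Cs i.
  have [A1|A1] := leqP #|carrier (s i)| 1; [left|by right; split=> //;
    exists i].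
  split; first exact: CA.
  by apply/eqP; rewrite eq_sym eqEcard sub1set rA cards1.
(* Here the label of a block vertex is the rooted graph hanging at it. *)
have wB := IH _ _ _ (rle_refl le_refl) (rle_trans le_trans) wparts.
pose D (g : lgraph Q) (h : lgraph (lgraph Q)) := exists B pi,
  [/\ retraction (@mult _ g) (carrier g) B pi, lroot g \in B &
    h = LGraph (@mult_sym _ g) B (fiber_part pi) (lroot g)].
apply: (wqo_reflect (D := D) wB).
  move=> g [[rA cA bA CA] A1 [i gi]].
  have [B [pi [retr rB B1 nB]]] := block_ex (@mult_sym _ g) cA rA A1.
  exists (LGraph (@mult_sym _ g) B (fiber_part pi) (lroot g));
    last by exists B, pi.
  split=> //; split=> //=.
  - exact: (retraction_conn (@mult_sym _ g) retr cA).
  - exact: (bonds_le_retraction (@mult_sym _ g) retr cA bA).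
  - by move=> b bB; exists i; rewrite -gi; exists B, pi, b.
move=> g h g' h' [[rA cA bA CA] _ _] [[rA' cA' bA' CA'] _ _].
move=> [B [pi [retr rB ->]]] [B' [pi' [retr' rB' ->]]] [f [/= cf rf lf]].
have Hc b : exists b', b \in B ->
    b' \in fiber B' f b /\ rle le (fiber_part pi b) (fiber_part pi' b').
  have [bB|bB] := boolP (b \in B); last by exists (lroot g').
  by have [b' b'F lb] := lf b bB; exists b'.
have [c Hc'] := choice _ Hc.
have Hh b : exists h : rvert g' -> rvert g, b \in B -> rcontracts le (g :=
  fiber_part pi b) (g' := fiber_part pi' (c b)) h.
  have [bB|bB] := boolP (b \in B); last by exists (fun _ => lroot g).
  by have [_ [h0 Hh0]] := Hc' b bB; exists h0.
have [h0 Hh0] := choice _ Hh.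
have cP b : b \in B -> c b \in fiber B' f b by move=> /Hc'[].
have cg b : b \in B -> contracts (@mult _ g') (@mult _ g) (fiber (carrier g')
  pi' (c b))
    (fiber (carrier g) pi b) (h0 b) /\ h0 b (c b) = b.
  by move=> /Hh0[].
exists (block_map pi' f c h0); split.
- exact: (contracts_block (@mult_sym _ g') cA' retr' retr cf cP cg).
- by rewrite (block_map_block retr' cf cg rB').
move=> x xA; have [_ piAB _ _] := retr; have bB := piAB x xA.
have xF : x \in fiber (carrier g) pi (pi x) by apply/fiberP.
have [_ _ /(_ x xF)[x' x'F lx]] := Hh0 _ bB.
exists x' => //; exact: (subsetP (fiber_block_map _ _ _ cP bB xF)).
Qed.

Theorem rooted_wqo_any k : rooted_wqo any_graph k.
Proof. by elim: k => [|k /wqo_blocks/wqo_rooted //]; apply: rooted_wqo0. Qed.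

(** * From multigraphs to multiplicity functions *)

Section Mgraph.
Variable G : mgraph.
Implicit Types (x y u v : vert G) (e : edge G) (A X Y : {set vert G}) (F : {set
  edge G}).

Definition gmult x y := #|[set e : edge G | ends e == [set x; y]]|.

Lemma gmult_sym x y : gmult x y = gmult y x.
Proof. by rewrite /gmult setUC. Qed.

Lemma gmult_gt0P x y : reflect (exists e, ends e = [set x; y]) (0 < gmult x y).
Proof.
rewrite card_gt0; apply: (iffP (set0Pn _)) => -[e].
  by rewrite inE => /eqP; exists e.
by move=> E; exists e; rewrite inE; apply/eqP.
Qed.

Lemma ends_ex e : exists x y, x != y /\ ends e = [set x; y].
Proof.
by have /eqP/cards2P[x [y [xy E]]] := ends_card2 e; exists x, y.
Qed.

Definition between X Y :=
  [set e : edge G | ~~ [disjoint ends e & X] && ~~ [disjoint ends e & Y]].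

Lemma betweenP X Y e : [disjoint X & Y] ->
  reflect (exists x y, [/\ x \in X, y \in Y & ends e = [set x;
    y]]) (e \in between X Y).
Proof.
move=> dXY; rewrite inE; apply: (iffP andP) => [[]|[x [y [xX yY ->]]]];
  last first.
  by split; apply/pred0Pn; [exists x|exists y]; rewrite /= !inE eqxx ?orbT.
have [s [t [st ->]]] := ends_ex e.
move=> /pred0Pn[x /=]; rewrite !inE => /andP[xst xX] /pred0Pn[y /=];
  rewrite !inE => /andP[yst yY].
have xy : x != y by apply: contraTneq xX => ->; rewrite (disjointFl dXY).
exists x, y; split=> //; apply/setP=> z; rewrite !inE.
case/orP: xst => /eqP xE; case/orP: yst => /eqP yE; subst x y => //.
- by rewrite eqxx in xy.
- by rewrite orbC.
- by rewrite eqxx in xy.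
Qed.

(** Double counting: as [X] and [Y] are disjoint, each edge between them comes from exactly one pair
    in [setX X Y]. *)
Lemma ecount_between X Y : [disjoint X & Y] ->
  ecount gmult X Y = #|between X Y|.
Proof.
move=> dXY; rewrite /ecount pair_big_dep /=.
transitivity (\sum_(p in setX X Y) \sum_(e : edge G | ends e == [set p.1;
  p.2]) 1).
  apply: eq_big => [[x y]|[x y] _]; first by rewrite inE.
  by rewrite /gmult -sum1_card; apply: eq_bigl => e; rewrite inE.
rewrite (exchange_big_dep predT) //= -sum1_card [RHS]big_mkcond /=.
apply: eq_bigr => e _; rewrite sum1dep_card.
case: (betweenP e dXY) => [[x [y [xX yY E]]]|no].
  rewrite -(cards1 (x, y)); apply: eq_card => -[x' y']; rewrite !inE /= E.
  apply/idP/eqP => [/andP[/andP[x'X y'Y] /eqP/setP E']|[-> ->]];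
    last by rewrite xX yY eqxx.
  have := E' x; have := E' y; rewrite !inE !eqxx orbT /= => /esym/orP[]/eqP yE
    /esym/orP[]/eqP xE.
  - by rewrite -yE (disjointFl dXY yY) in x'X.
  - by rewrite -yE (disjointFl dXY yY) in x'X.
  - by rewrite xE yE.
  - by rewrite -xE (disjointFr dXY xX) in y'Y.
apply: eq_card0 => -[x y]; rewrite !inE /=; apply/negP => /andP[/andP[xX yY]
  /eqP E].
by apply: no; exists x, y.
Qed.

Lemma adjacent_gmult x y : adjacent x y = (0 < gmult x y).
Proof.
apply/existsP/gmult_gt0P => -[e E]; exists e; first exact/eqP.
by apply/eqP.
Qed.

Lemma conn_connect (r : rel (vert G)) A x y : conn gmult A ->
  (forall u v, u \in A -> v \in A -> 0 < gmult u v -> r u v) ->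
  x \in A -> y \in A -> connect r x y.
Proof.
move=> cA Hr xA yA; apply: contraT => xy.
have [||u [v [uA ux vA vx uv]]] := @conn_cross _ _ A [set z | connect r x z] x
  y cA xA _ yA.
- by rewrite inE.
- by rewrite inE.
rewrite !inE in ux vx; case/negP: vx; apply: connect_trans ux (connect1 _).
exact: Hr.
Qed.

End Mgraph.

Lemma adjacent_sym (G : mgraph) : symmetric (@adjacent G).
Proof. by move=> x y; rewrite !adjacent_gmult gmult_sym. Qed.

(** [root e1] maps the roots of [e2] onto those of [e1]. It is not injective, since the distinct
    [e2]-roots of [x] and [y] have the same image. *)
Lemma n_comp_lt (T : finType) (e1 e2 : rel T) x y :
  connect_sym e1 -> connect_sym e2 -> subrel e2 e1 ->
  connect e1 x y -> ~~ connect e2 x y -> n_comp e1 predT < n_comp e2 predT.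
Proof.
move=> s1 s2 e21 xy1 xy2.
have c21 u v : connect e2 u v -> connect e1 u v.
  by apply: connect_sub => u' v' /e21/connect1.
have rootsE e : n_comp e predT = #|[set z | roots e z]|.
  by apply: eq_card => z; rewrite !inE andbT.
rewrite !rootsE; set R2 := [set z | roots e2 z].
have <- : root e1 @: R2 = [set z | roots e1 z].
  apply/setP=> z; rewrite inE; apply/imsetP/idP => [[u _ ->]|rz];
    first exact: roots_root.
  exists (root e2 z); first by rewrite inE; apply: roots_root.
  rewrite -[LHS](eqP rz); apply/(rootP s1)/c21; exact: connect_root.
rewrite ltn_neqAle leq_imset_card andbT; apply/negP => /imset_injP inj.
case/negP: xy2; apply/(rootP s2)/inj; rewrite ?inE ?roots_root //.
apply/(rootP s1); apply: connect_trans (_ : connect e1 _ x) _.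
  by rewrite s1; apply/c21/connect_root.
by apply: connect_trans xy1 _; apply/c21/connect_root.
Qed.

(** Without these edges [X] is closed under adjacency, hence cut off from [Y]. If a single one of
    them survives, it still joins the connected sets [X] and [Y], and the components do not
    change. *)
Lemma bond_between (G : mgraph) (X Y : {set vert G}) :
  conn (@gmult G) X -> conn (@gmult G) Y -> [disjoint X & Y] ->
  X != set0 -> Y != set0 -> touch (@gmult G) X Y ->
  ~~ touch (@gmult G) X (~: (X :|: Y)) -> bond (between X Y).
Proof.
move=> cX cY dXY /set0Pn[x xX] /set0Pn[y yY] tXY nX.
have del_sym (F : {set edge G}) : connect_sym (@adjacent (del_edges F)).
  exact: sym_connect_sym (@adjacent_sym _).
have adjP (F : {set edge G}) (u v : vert G) : reflect (exists2 e, e \notin F &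
  ends e = [set u; v])
    (@adjacent (del_edges F) u v).
  apply: (iffP existsP) => [[e /eqP E]|[e eF E]].
    by exists (val e) => //; apply: (valP e).
  by exists (exist _ e eF); apply/eqP.
have subG (F : {set edge G}) : subrel (@adjacent (del_edges F)) (@adjacent G).
  by move=> u v /adjP[e _ E]; rewrite adjacent_gmult; apply/gmult_gt0P;
    exists e.
apply/minsetP; split.
  apply: (@n_comp_lt _ _ _ x y) => //.
  - exact: sym_connect_sym (@adjacent_sym _).
  - exact: del_sym.
  - exact: subG.
  - have cXY : conn (@gmult G) (X :|: Y) by apply: connU_touch => //;
      apply: gmult_sym.
    apply: (conn_connect cXY); rewrite ?inE ?xX ?yY ?orbT // => u v _ _.
    by rewrite adjacent_gmult.
  apply/negP => xy; have clX : closed (@adjacent (del_edges (between X Y))) X.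
    apply: (intro_closed (del_sym _)) => u v /= /adjP[e eF E] uX.
    apply: contraR eF => vX; apply/(betweenP _ dXY); exists u, v; split=> //.
    have uv : 0 < @gmult G u v by apply/gmult_gt0P; exists e.
    apply: contraR nX => vY; apply/touchP; exists u, v; split=> //.
    by rewrite !inE negb_or vX.
  by have := closed_connect clX xy; rewrite /= xX (disjointFl dXY yY).
move=> F sepF FXY; apply/eqP; rewrite eqEsubset FXY; apply/subsetP => e0 e0XY.
apply: contraT => e0F; suff : n_components G = n_components (del_edges F).
  by move=> E; move: sepF; rewrite /separating E ltnn.
apply: eq_n_comp => u v; apply/idP/idP; last first.
  by apply: connect_sub => a b /subG/connect1.
have inside (Z : {set vert G}) : conn (@gmult G) Z -> [disjoint Z & X] \/
  [disjoint Z & Y] ->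
    forall a b, a \in Z -> b \in Z -> connect (@adjacent (del_edges F)) a b.
  move=> cZ dZ a b; apply: conn_connect cZ _ => {}a {}b aZ bZ /gmult_gt0P[e E].
  apply/adjP; exists e => //; apply/negP => /(subsetP FXY).
  rewrite inE E => /andP[/pred0Pn[s /= /andP[sab sX]] /pred0Pn[t /= /andP[tab
    tY]]].
  have inZ z : z \in [set a; b] -> z \in Z by rewrite !inE => /orP[]/eqP->.
  case: dZ => /disjointFr dZ; first by rewrite dZ ?inZ in sX.
  by rewrite dZ ?inZ in tY.
have [x0 [y0 [x0X y0Y E0]]] := betweenP _ dXY e0XY.
have join a b : a \in X -> b \in Y -> connect (@adjacent (del_edges F)) a b.
  move=> aX bY; apply: connect_trans (inside X cX (or_intror dXY) a x0 aX x0X)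
    _.
  apply: connect_trans (connect1 _) (inside Y cY _ y0 b y0Y bY).
    by apply/adjP; exists e0.
  by left; rewrite disjoint_sym.
apply: connect_sub => a b; rewrite adjacent_gmult => /gmult_gt0P[e E].
have [eF|eF] := boolP (e \in F); last by apply: connect1; apply/adjP; exists e.
have [a' [b' [a'X b'Y E']]] := betweenP _ dXY (subsetP FXY _ eF).
have : a' != b' by apply: contraTneq a'X => ->; rewrite (disjointFl dXY).
have : a' \in [set a; b] by rewrite -E E' !inE eqxx.
have : b' \in [set a; b] by rewrite -E E' !inE eqxx orbT.
rewrite !inE => /orP[]/eqP bE /orP[]/eqP aE; subst a' b'; rewrite ?eqxx // => _.
  by rewrite del_sym; apply: join.
exact: join.
Qed.

(** Components are peeled off one at a time, to suit products of well-quasi-orders and induction on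
    [p]. The equation for [A] expresses that [X] is contained in it. *)
Fixpoint comps (V : finType) (m : V -> V -> nat) k p (A : {set V}) : Prop :=
  if p is p'.+1 then
    A = set0 \/ exists X, [/\ A = X :|: (A :\: X), X != set0, ~~ touch m X (A
      :\: X),
      conn m X /\ bonds_le m k X & comps m k p' (A :\: X)]
  else A = set0.

Lemma mgraph_bonds_le (G : mgraph) k (X : {set vert G}) :
  (forall F : {set edge G}, bond F -> #|F| <= k) ->
  ~~ touch (@gmult G) X (~: X) ->
  conn (@gmult G) X -> bonds_le (@gmult G) k X.
Proof.
move=> bG nX cX Y YX Y0 YnX cY cXY.
have dY : [disjoint Y & X :\: Y] by rewrite disjoint_sym disjoints_subset
  subsetDr.
have XY0 : X :\: Y != set0.
  by rewrite setD_eq0; apply: contra YnX => XY; rewrite eqEsubset YX.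
rewrite ecount_between //; apply/bG/bond_between => //.
  have [y yY] := set0Pn _ Y0; have [x xXY] := set0Pn _ XY0.
  move: xXY; rewrite inE => /andP[xY xX].
  have [u [v [uX uY vX vY uv]]] := conn_cross cX (subsetP YX _ yY) yY xX xY.
  by apply/touchP; exists u, v; rewrite inE vY.
apply: contra nX; apply: touchS => //.
by rewrite setCS -{1}(setIidPr YX) setID.
Qed.

Lemma mgraph_comps (G : mgraph) k p (A : {set vert G}) :
  (forall F : {set edge G}, bond F -> #|F| <= k) ->
  closed (@adjacent G) A -> n_comp (@adjacent G) A <= p ->
  comps (@gmult G) k p A.
Proof.
move=> bG; have csym := sym_connect_sym (@adjacent_sym G).
elim: p A => [|p IH] A clA pA /=; last have [->|[x xA]] := set_0Vmem A;
  try by left.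
  apply/setP=> x; rewrite in_set0; apply/negP => xA.
  move: pA; rewrite leqn0 => /eqP/card0_eq/(_ (root (@adjacent G) x)).
  rewrite !inE /= roots_root // -(closed_connect clA (connect_root _ x)).
  by rewrite xA.
right; pose X := [set y | connect (@adjacent G) x y].
have XA : X \subset A.
  by apply/subsetP=> y; rewrite inE => /(closed_connect clA) <-.
have clX : closed (@adjacent G) X.
  apply: (intro_closed csym) => u v uv; rewrite !inE => xu.
  exact: connect_trans xu (connect1 uv).
have nX : ~~ touch (@gmult G) X (~: X).
  apply/touchP => -[u [v [uX vX uv]]]; rewrite -adjacent_gmult in uv.
  by move: vX; rewrite inE -(clX _ _ uv) uX.
have cX : conn (@gmult G) X.
  apply: (@connI _ _ (@gmult_sym G) X x); first by rewrite inE connect0.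
  move=> U y yX yU xU; apply: NNPP => no.
  suff clU : closed (@adjacent G) (X :&: U).
    have xy : connect (@adjacent G) x y by rewrite inE in yX.
    by have := closed_connect clU xy; rewrite !in_setI (negPf xU) yU yX andbF.
  apply: (intro_closed csym) => u v uv /setIP[uX uU].
  have vX : v \in X by rewrite -(clX _ _ uv).
  rewrite inE vX; apply: contraT => vU; case: no; exists u, v.
  by split=> //; rewrite -adjacent_gmult.
exists X; split.
- by rewrite -{1}(setID A X) (setIidPr XA).
- by apply/set0Pn; exists x; rewrite inE connect0.
- by apply: contra nX; apply: touchS => //; rewrite -setTD setSD.
- by split=> //; apply: mgraph_bonds_le.
apply: IH.
  by move=> u v uv; rewrite !in_setD (clX _ _ uv) (clA _ _ uv).
(* The root representing the component [X] is counted for [A] but not for [A :\: X]. *)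
rewrite -ltnS; apply: leq_trans pA; apply: proper_card; apply/properP; split.
  by apply/subsetP => y; rewrite !inE => /andP[-> /andP[_ ->]].
exists (root (@adjacent G) x).
  by rewrite !inE roots_root //= -(closed_connect clA (connect_root _ x)).
by rewrite !inE roots_root //= connect_root.
Qed.

Definition located := {G : mgraph & {set vert G}}.

(** The first alternative covers empty sets: a total map into [vert (projT1 a)] need not exist when
    that type is empty. *)
Definition located_le (a b : located) :=
  (projT2 a = set0 /\ projT2 b = set0) \/
  exists f : vert (projT1 b) -> vert (projT1 a),
    contracts (@gmult _) (@gmult _) (projT2 b) (projT2 a) f /\
    forall x, x \in projT2 a -> exists2 x', x' \in projT2 b & f x' = x.

Lemma wqo_comps k p :
  well_quasi_ordered (fun a : located => comps (@gmult (projT1 a)) k p (projT2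
    a)) located_le.
Proof.
have wqo0 : well_quasi_ordered (fun a : located => projT2 a = set0) located_le.
  by move=> s Hs; exists 0, 1; split=> //; left.
elim: p => [|p IH] //=; apply: wqoU => //.
have wr : well_quasi_ordered (fun g => rgood (fun _ => True) k g /\ any_graph
  g) (rle (@eq unit)).
  apply: rooted_wqo_any => // [y x z -> //|s _].
  by exists 0, 1; split=> //; case: (s 0) (s 1) => -[].
have eq_tr : forall y x z : unit, x = y -> y = z -> x = z by move=> y x z ->.
pose D (a : located) (q : lgraph unit * located) := exists X r,
  [/\ projT2 a = X :|: (projT2 a :\: X), r \in X, ~~ touch (@gmult _) X (projT2
    a :\: X),
    q.1 = LGraph (@gmult_sym (projT1 a)) X (fun _ => tt) r &
    q.2 = existT (fun G => {set vert G}) (projT1 a) (projT2 a :\: X)].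
apply: (wqo_reflect (D := D) (wqo_prod (rle_trans eq_tr) wr IH)).
  move=> [G A] /= [X [AE X0 nX [cX bX] cA]]; have [r rX] := set0Pn _ X0.
  exists (LGraph (@gmult_sym G) X (fun _ => tt) r, existT _ G (A :\: X));
    last by exists X, r.
  by split.
move=> [G A] [h1 h2] [G' A'] [h1' h2'] _ _ /=.
move=> [X [r [/= AE rX nX -> ->]]] [X' [r' [/= AE' rX' nX' -> ->]]] [[f [/= cf
  rf lf]] le2].
right => /=; have surjf x : x \in X -> exists2 x', x' \in X' & f x' = x.
  by move=> xX; have [x' /fiberP[x'X fx'] _] := lf x xX; exists x'.
have dis (V : finType) (Z B : {set V}) : [disjoint Z & B :\: Z].
  by rewrite disjoint_sym disjoints_subset subsetDr.
have [[/= E E']|[/= g [cg surjg]]] := le2.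
  by exists f; rewrite AE AE' E E' !setU0.
have [a [b J]] := joins_ex (@gmult G) X (A :\: X).
have [a' [b' J']] := joins_ex (@gmult G') X' (A' :\: X').
(* No edge leaves a component, so the gluing is along a bond with zero edges and its conditions on
   indices in ['I_0] are vacuous. *)
move: a b J a' b' J'; rewrite !ecount_eq0 // => a b J a' b' J'.
exists (glue X' f g); rewrite AE AE'; split.
  by apply: (contracts_glue (@gmult_sym _) (@gmult_sym _) (dis _ _ _) (dis _ _
    _) cf cg J' J) => -[].
move=> x /setUP[/surjf[x' x'X <-]|/surjg[x' x'A <-]]; exists x';
  rewrite ?inE ?x'X //.
- by rewrite /glue x'X.
- by move: x'A; rewrite inE => ->; rewrite orbT.
by rewrite /glue; move: x'A; rewrite inE => /andP[/negPf->].
Qed.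

(** * Realizing vertex maps by sequences of edge contractions *)

Lemma fiber_injection (E E' : finType) (T : eqType)
    (k : E -> T) (k' : E' -> T) :
  (forall t, #|[set e | k e == t]| = #|[set e | k' e == t]|) ->
  exists2 h : E -> E', injective h & forall e, k' (h e) = k e.
Proof.
move=> Hc; pose S t := [set e | k e == t].
have eS e : e \in S (k e) by rewrite inE.
pose h t e (q : e \in S t) := enum_val (cast_ord (Hc t) (enum_rank_in q e)).
have kh e : k' (h _ _ (eS e)) = k e.
  by have := enum_valP (cast_ord (Hc (k e)) (enum_rank_in (eS e) e));
    rewrite inE => /eqP.
have inj_h t1 t2 e1 e2 (q1 : e1 \in S t1) (q2 : e2 \in S t2) :
    t1 = t2 -> h _ _ q1 = h _ _ q2 -> e1 = e2.
  move=> Et; subst t2 => /enum_val_inj/cast_ord_inj/(congr1 enum_val).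
  by rewrite !enum_rankK_in.
have inj e1 e2 : h _ _ (eS e1) = h _ _ (eS e2) -> e1 = e2.
  by move=> E12; apply: inj_h (E12); rewrite -kh E12 kh.
by exists (fun e => h _ _ (eS e)).
Qed.

Lemma fiber_bijection (E E' : finType) (T : eqType)
    (k : E -> T) (k' : E' -> T) :
  (forall t, #|[set e | k e == t]| = #|[set e | k' e == t]|) ->
  exists2 h : E -> E', bijective h & forall e, k' (h e) = k e.
Proof.
move=> Hc; have [h inj_h kh] := fiber_injection Hc; exists h => //.
have [h' inj_h' _] := fiber_injection (fun t => esym (Hc t)).
exact: inj_card_bij inj_h (leq_card _ inj_h').
Qed.

Lemma fiber_disjoint (V W : finType) (A : {set V}) (f : V -> W) x y :
  x != y -> [disjoint fiber A f x & fiber A f y].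
Proof.
move=> xy; rewrite -setI_eq0; apply/eqP/setP => z; rewrite !inE; apply/negP.
by move=> /andP[/andP[_ /eqP zx] /andP[_ /eqP zy]]; rewrite -zx -zy eqxx in xy.
Qed.

(** Induction on the number of vertices of [G]. If [f] identifies two vertices, their connected
    fiber contains an edge, and [f] factors through contracting it. If [f] is injective, it is a
    bijection, and equal multiplicities give an isomorphism. *)
Lemma contraction_of_contracts (G H : mgraph) (f : vert G -> vert H) :
  contracts (@gmult G) (@gmult H) setT setT f ->
  (forall x, exists x', f x' = x) ->
  contraction H G.
Proof.
have [n] := ubnP #|vert G|; elim: n G f => // n IH G f leGn cf surj.
have [_ fc fm] := cf; have fibE x : fiber setT f x = f @^-1: [set x].
  by apply/setP=> z; rewrite !inE.
have [inj|ninj] := classic (injective f).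
  have /choice[g fg] := surj; have gf : cancel f g by move=> x; apply: inj;
    rewrite fg.
  have bg : bijective g by exists f.
  (* Edges are matched class by class, a class being the set of parallel edges with given ends. *)
  have [|h bh hE] := @fiber_bijection (edge H) (edge G) _ (fun e => g @: ends
    e) (@ends G).
    move=> t; have [/cards2P[a [b [ab ->]]]|t2] := boolP (#|t| == 2);
      last first.
      rewrite !(@eq_card0 _ [set _ | _]) // => e; rewrite inE;
        apply: contraNF t2 => /eqP <-.
        by rewrite ends_card2.
      by rewrite card_imset ?ends_card2 //; apply: bij_inj.
    rewrite -[RHS]/(gmult a b); transitivity (gmult (f a) (f b)).
      apply: eq_card => e; rewrite !inE; apply/eqP/eqP => [E|->].
        by rewrite -[ends e](imset_id) -(eq_imset _ fg) imset_comp E imsetU1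
          imset_set1.
      by rewrite imsetU1 imset_set1 !gf.
    rewrite fm ?inE ?(inj_eq inj) // !fibE.
    have pre x : f @^-1: [set f x] = [set x] by apply/setP=> z;
      rewrite !inE (inj_eq inj).
    by rewrite !pre /ecount !big_set1.
  by apply: contraction_iso; exists g, h; split.
have [u [v [uv fuv]]] : exists u v, u != v /\ f u = f v.
  apply: NNPP => no; apply: ninj => u v fuv; apply/eqP; apply: contraT => uv.
  by case: no; exists u, v.
have uF : u \in fiber setT f (f u) by apply/fiberP.
have vF : v \in fiber setT f (f u) by apply/fiberP; rewrite fuv.
have vu : v \notin [set u] by rewrite inE eq_sym.
have [u0 [w [_ uu wF wu uw]]] := conn_cross (fc (f u) (in_setT _)) uF (set11 u)
  vF vu.
move: uu wF wu uw; rewrite !inE => /eqP-> /= /eqP fw wu uw {u0}.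
rewrite eq_sym in wu.
apply: (contraction_step (neq_xy := wu)); first by rewrite adjacent_gmult.
set pi := contract_proj wu.
have pif x : f (val (pi x)) = f x.
  by rewrite /pi /contract_proj val_insubd; case: ifP => //= /negbFE/eqP->.
have valK' z : pi (val z) = z by rewrite /pi /contract_proj valKd.
apply: (IH (contract wu) (fun z => f (val z))).
- rewrite -ltnS; apply: leq_trans leGn; rewrite ltnS card_sig;
    apply: proper_card; apply/properP; split.
    exact/subsetP.
  by exists w; rewrite ?inE ?eqxx.
- have edge_lift (e : edge G) s t : ends e = [set s; t] -> pi s != pi t ->
      exists2 e' : contract_edge wu, val e' = e & contract_ends e' = [set pi s;
        pi t].
    move=> E st; have e2 : #|contract_proj wu @: ends e| == 2.
      by rewrite E imsetU1 imset_set1 cards2 st.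
    exists (exist _ e e2); first by [].
    by rewrite /contract_ends /= E imsetU1 imset_set1.
  split=> // [x _|x y _ _ xy].
    apply/forallP => U; have := forallP (fc x (in_setT _)) (pi @^-1: U).
    case/or3P=> [/eqP/setP E|/eqP/setP E|/touchP[s [t [sF tF st]]]]; apply/or3P.
    + constructor 1; apply/eqP/setP => z; have := E (val z).
      by rewrite !inE valK'.
    + constructor 2; apply/eqP/setP => z; have := E (val z).
      by rewrite !inE valK'.
    move: sF tF; rewrite !inE => /andP[sx sU] /andP[tU tx].
    have [e E] := gmult_gt0P _ _ st.
    constructor 3; apply/touchP; exists (pi s), (pi t);
      rewrite !inE !pif sx sU tx tU; split=> //.
    have [|e' _ E'] := edge_lift e s t E; first by apply: contraNneq tU => <-.
    by apply/gmult_gt0P; exists e'.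
  rewrite fm ?inE // !ecount_between ?fiber_disjoint //.
  (* The projection respects the fibers of [f], so the edges between two fibers are the same before
     and after the contraction; by [edge_lift] none of them becomes a loop. *)
  have meets (D : {set vert G}) z :
      [disjoint pi @: D & fiber setT (fun z => f (val z)) z] = [disjoint D &
        fiber setT f z].
    apply/pred0P/pred0P => noD s; apply/negP => /= /andP[].
      move=> sD /fiberP[_ fs]; have /negP[] := negbT (noD (pi s)).
      by rewrite /= imset_f //; apply/fiberP; rewrite pif.
    move=> /imsetP[t tD ->] /fiberP[_]; rewrite pif => ft;
      have /negP[] := negbT (noD t).
    by rewrite /= tD; apply/fiberP.
  rewrite -[RHS](card_imset _ val_inj); apply: eq_card => e.
  apply/idP/imsetP => [|[e' e'B ->]]; last first.
    by move: e'B; rewrite !inE !meets.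
  move=> eB; have [s [t [/fiberP[_ sx] /fiberP[_ ty] E]]] := betweenP _
    (fiber_disjoint _ _ xy) eB.
  have [|e' E' _] := edge_lift e s t E.
    by apply: contra_neq xy => st; rewrite -sx -ty -(pif s) st pif.
  exists e'; last by rewrite E'.
  by move: eB; rewrite !inE !meets E'.
by move=> x; have [x' <-] := surj x; exists (pi x'); rewrite pif.
Qed.

Theorem theorem1 (p k : nat) :
  well_quasi_ordered (bounded_components_bonds p k) contraction.
Proof.
move=> s Hs; have [|i [j [ij le_ij]]] := @wqo_comps k p (fun i => existT _ (s
  i) setT).
  move=> i /=; have [cp bk] := Hs i; apply: mgraph_comps => //.
    by move=> x y _; rewrite !inE.
  by rewrite (eq_n_comp_r (a' := predT)) // => x; rewrite inE.
exists i, j; split=> //; case: le_ij => /= [[Ei Ej]|[f [cf surj]]].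
  have noi x : x \in [set: vert (s i)] -> False by rewrite Ei inE.
  have noj x : x \in [set: vert (s j)] -> False by rewrite Ej inE.
  apply: (@contraction_of_contracts _ _ (fun x => False_rect _ (noj x (in_setT
    x)))).
    by split=> x; [move=> /noj|move=> /noi|move=> y /noi].
  by move=> x; case: (noi x (in_setT x)).
by apply: (contraction_of_contracts cf) => x; have [x' _ <-] := surj x (in_setT
  x); exists x'.
Qed.
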